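(* Let $J=\Delta+K$ be a Jacobi operator with $K$ compact, with diagonal entries $(\alpha_k)_{k\ge0}$ and off-diagonal entries $(\beta_k)_{k\ge0}$. If for all $\epsilon>0$ an integer $m$ can be computed such that $$\sup_{k\ge m}|\alpha_k|+\sup_{k\ge m}\left|\beta_k-\tfrac12\right|<\epsilon,$$ then the spectrum $\sigma(J)$ can be computed with error control in the Hausdorff metric.
   Context: A Jacobi operator $J$ is a bounded self-adjoint operator on $\ell^2(\{0,1,2,\dots\})$ given by a symmetric tridiagonal matrix with real diagonal entries $\alpha_k$ and off-diagonal entries $\beta_k>0$. The free Jacobi operator $\Delta$ has diagonal entries $0$ and off-diagonal entries $\tfrac12$. The Hausdorff metric on compact subsets of $\mathbb C$ is $d_H(A,B)=\max\{\sup_{a\in A}\mathrm{dist}(a,B),\sup_{b\in B}\mathrm{dist}(b,A)\}$. Computational model. The input is the operator $J$, which can be accessed only by reading individual matrix entries, together with an oracle that for each $\epsilon>0$ returns an integer $m$ as in the claim. A general algorithm is a map $\Gamma$ from inputs to outputs (here, compact subsets of $\mathbb R$) such that for each input $A$ the output $\Gamma(A)$ depends only on a finite set $\Lambda_\Gamma(A)$ of evaluations of $A$, and if $B$ is an input whose evaluations agree with those of $A$ on $\Lambda_\Gamma(A)$ then $\Lambda_\Gamma(B)=\Lambda_\Gamma(A)$. Exact real-number arithmetic is assumed: algorithms perform finitely many arithmetic operations and comparisons on real numbers, starting from the data read. A set-valued function $\Xi$ of the input is computable with error control if there are such algorithms $\Gamma_1,\Gamma_2,\dots$ with $\Gamma_N(A)\to\Xi(A)$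 in $d_H$ as $N\to\infty$ for every input $A$, and for each input $A$ and each $\epsilon>0$ one can compute (in the same sense) an $N$ for which $d_H(\Gamma_N(A),\Xi(A))<\epsilon$ is guaranteed. (An output may be a finite union of points and intervals, described by finitely many real numbers.) *)

(* Defs.v *)
From HB Require Import structures.
From mathcomp Require Import all_boot all_order all_algebra.
From mathcomp Require Import complex.
From mathcomp Require Import all_classical all_reals all_analysis.

Set Implicit Arguments.
Unset Strict Implicit.
Unset Printing Implicit Defensive.

Import Order.TTheory GRing.Theory Num.Theory.
Import numFieldNormedType.Exports.

Local Open Scope classical_set_scope.
Local Open Scope ring_scope.
Local Open Scope complex_scope.

(** * Operators on the complex Hilbert space l^2({0,1,2,...})

    A vector of l^2 is a sequence satisfying [ell2]; an operator is a map on
    all sequences of which only the restriction to l^2 matters. *)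

Definition ell2 (R : realType) (u : nat -> R[i]) : Prop :=
  cvgn (series (fun k => Normc.normc (u k) ^+ 2)).

Definition norm2 (R : realType) (u : nat -> R[i]) : R :=
  Num.sqrt (limn (series (fun k => Normc.normc (u k) ^+ 2))).

Definition inner (R : realType) (u v : nat -> R[i]) : R[i] :=
  limn (series (fun k => complex.Re (u k * (v k)^*)))
  +i* limn (series (fun k => complex.Im (u k * (v k)^*))).

Definition operator (R : realType) := (nat -> R[i]) -> (nat -> R[i]).

Definition linear_operator (R : realType) (T : operator R) : Prop :=
  (forall u, ell2 u -> ell2 (T u)) /\
  (forall (a : R[i]) u v, ell2 u -> ell2 v ->
     T (fun k => a * u k + v k) = (fun k => a * T u k + T v k)).

Definition bounded_operator (R : realType) (T : operator R) : Prop :=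
  linear_operator T /\
  exists M : R, forall u, ell2 u -> norm2 (T u) <= M * norm2 u.

Definition self_adjoint (R : realType) (T : operator R) : Prop :=
  forall u v, ell2 u -> ell2 v -> inner (T u) v = inner u (T v).

Definition compact_operator (R : realType) (T : operator R) : Prop :=
  linear_operator T /\
  forall u : nat -> (nat -> R[i]),
    (forall n, ell2 (u n)) -> (exists M : R, forall n, norm2 (u n) <= M) ->
    exists phi : nat -> nat, {homo phi : m n / (m < n)%N} /\
    exists v : nat -> R[i], ell2 v /\
      norm2 (T (u (phi n)) \- v) @[n --> \oo] --> (0 : R).

Definition spectrum (R : realType) (T : operator R) : set R[i] :=
  [set z | ~ exists S : operator R, bounded_operator S /\
     forall u, ell2 u ->
       S (fun k => T u k - z * u k) = u /\
       (fun k => T (S u) k - z * S u k) = u].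

(** * Jacobi operators *)

Definition jacobi_entry (R : realType) (a b : nat -> R) (i j : nat) : R :=
  if i == j then a i
  else if j == i.+1 then b i
  else if i == j.+1 then b j
  else 0.

(* Entries beyond column i + 1 of row i vanish, so the sum is the full row. *)
Definition jacobi_op (R : realType) (a b : nat -> R) : operator R :=
  fun u i => \sum_(j < i.+2) (jacobi_entry a b i j)%:C * u j.

Definition free_jacobi (R : realType) : operator R :=
  jacobi_op (fun=> 0) (fun=> 2^-1).

Definition jacobi_operator (R : realType) (a b : nat -> R) : Prop :=
  [/\ forall k, 0 < b k,
      bounded_operator (jacobi_op a b) &
      self_adjoint (jacobi_op a b)].

(** * Hausdorff distance

    Extended-real valued, so that a nonempty set is at distance +oo (and not
    at a default real value) from the empty set. *)

Definition dist_set (R : realType) (z : R[i]) (B : set R[i]) : \bar R :=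
  ereal_inf [set (Normc.normc (z - w))%:E | w in B].

Definition hausdorff (R : realType) (A B : set R[i]) : \bar R :=
  Order.max (ereal_sup [set dist_set a B | a in A])
            (ereal_sup [set dist_set b A | b in B]).

(** * Inputs and their evaluations *)

Record input (R : realType) := Input {
  diag : nat -> R;
  offdiag : nat -> R;
  tail_index : R -> nat
}.

Definition jacobi_of (R : realType) (A : input R) : operator R :=
  jacobi_op (diag A) (offdiag A).

(* Both suprema are over bounded sets when [jacobi_of A] is bounded. *)
Definition tail_size (R : realType) (A : input R) (m : nat) : R :=
  sup [set `|diag A k| | k in [set k | (m <= k)%N]] +
  sup [set `|offdiag A k - 2^-1| | k in [set k | (m <= k)%N]].

Definition compactly_perturbed_inputs (R : realType) : set (input R) :=
  [set A | [/\ jacobi_operator (diag A) (offdiag A),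
               compact_operator (fun u => jacobi_of A u \- free_jacobi u) &
               forall e : R, 0 < e -> tail_size A (tail_index A e) < e]].

(* [inl (i, j)] reads the (i, j) matrix entry, [inr e] asks for the integer
   belonging to the tolerance e. *)
Definition query (R : realType) : Type := (nat * nat + R)%type.

Definition evaluate (R : realType) (A : input R) (q : query R) : R :=
  match q with
  | inl (i, j) => jacobi_entry (diag A) (offdiag A) i j
  | inr e => (tail_index A e)%:R
  end.

(** * General algorithms *)

(* [L A] is the set of evaluations on which the output on A depends. *)
Definition general_algorithm (R : realType) (X : Type) (Omega : set (input R))
    (G : input R -> X) (L : input R -> set (query R)) : Prop :=
  forall A, Omega A ->
    finite_set (L A) /\
    forall B, Omega B -> (forall q, L A q -> evaluate A q = evaluate B q) ->
      L B = L A /\ G B = G A.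

(** * Finite computations with exact real arithmetic

    While-programs for a machine with natural-number registers (for control
    and addressing) and an indirectly addressed memory of real numbers.  No
    real constant is available except those obtained from natural numbers by
    arithmetic.  Inversion is total, with 0^-1 = 0. *)

Inductive nexp :=
| NConst of nat
| NReg of nat
| NAdd of nexp & nexp
| NSub of nexp & nexp
| NMul of nexp & nexp.

Inductive rexp :=
| RNat of nexp
| RMem of nexp
| RAdd of rexp & rexp
| ROpp of rexp
| RMul of rexp & rexp
| RInv of rexp.

Inductive bexp :=
| BLe of rexp & rexp
| BNot of bexp
| BAnd of bexp & bexp.

Inductive program :=
| Skip
| SetReg of nat & nexp
| SetMem of nexp & rexp
(* [ReadEntry d i j]: store the (i, j) matrix entry in memory cell d *)
| ReadEntry of nexp & nexp & nexp
(* [AskTail x e]: store the oracle's integer for tolerance e in register x *)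
| AskTail of nat & rexp
| Seq of program & program
| IfThenElse of bexp & program & program
| While of bexp & program.

Record state (R : realType) := State { reg : nat -> nat; mem : nat -> R }.

Definition update (X : Type) (f : nat -> X) (a : nat) (x : X) : nat -> X :=
  fun b => if b == a then x else f b.

Definition set_reg (R : realType) (s : state R) (x n : nat) : state R :=
  State (update (reg s) x n) (mem s).

Definition set_mem (R : realType) (s : state R) (a : nat) (x : R) : state R :=
  State (reg s) (update (mem s) a x).

Fixpoint neval (R : realType) (s : state R) (e : nexp) : nat :=
  match e with
  | NConst n => n
  | NReg x => reg s x
  | NAdd e1 e2 => (neval s e1 + neval s e2)%N
  | NSub e1 e2 => (neval s e1 - neval s e2)%N
  | NMul e1 e2 => (neval s e1 * neval s e2)%N
  end.

Fixpoint reval (R : realType) (s : state R) (e : rexp) : R :=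
  match e with
  | RNat n => (neval s n)%:R
  | RMem a => mem s (neval s a)
  | RAdd e1 e2 => reval s e1 + reval s e2
  | ROpp e1 => - reval s e1
  | RMul e1 e2 => reval s e1 * reval s e2
  | RInv e1 => (reval s e1)^-1
  end.

Fixpoint beval (R : realType) (s : state R) (b : bexp) : bool :=
  match b with
  | BLe e1 e2 => reval s e1 <= reval s e2
  | BNot b1 => ~~ beval s b1
  | BAnd b1 b2 => beval s b1 && beval s b2
  end.

(* [exec A p s t s']: on input A, program p started in state s halts in state
   s' after making the evaluations listed in t. *)
Inductive exec (R : realType) (A : input R) :
    program -> state R -> seq (query R) -> state R -> Prop :=
| exec_skip s : exec A Skip s [::] s
| exec_reg s x e : exec A (SetReg x e) s [::] (set_reg s x (neval s e))
| exec_mem s a e :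
    exec A (SetMem a e) s [::] (set_mem s (neval s a) (reval s e))
| exec_entry s a i j :
    exec A (ReadEntry a i j) s [:: inl (neval s i, neval s j)]
      (set_mem s (neval s a)
         (jacobi_entry (diag A) (offdiag A) (neval s i) (neval s j)))
| exec_tail s x e :
    exec A (AskTail x e) s [:: inr (reval s e)]
      (set_reg s x (tail_index A (reval s e)))
| exec_seq p1 p2 s1 s2 s3 t1 t2 :
    exec A p1 s1 t1 s2 -> exec A p2 s2 t2 s3 ->
    exec A (Seq p1 p2) s1 (t1 ++ t2) s3
| exec_if b p1 p2 s t s' :
    exec A (if beval s b then p1 else p2) s t s' ->
    exec A (IfThenElse b p1 p2) s t s'
| exec_while_false b p s :
    beval s b = false -> exec A (While b p) s [::] s
| exec_while_true b p s1 s2 s3 t1 t2 :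
    beval s1 b = true ->
    exec A p s1 t1 s2 -> exec A (While b p) s2 t2 s3 ->
    exec A (While b p) s1 (t1 ++ t2) s3.

(* G is a general algorithm on Omega whose value and set of evaluations are
   produced by the program p, started in s0 and read off by [decode]. *)
Definition algorithm (R : realType) (X : Type) (Omega : set (input R))
    (p : program) (s0 : state R) (decode : state R -> X)
    (G : input R -> X) : Prop :=
  exists L : input R -> set (query R),
    general_algorithm Omega G L /\
    forall A, Omega A -> exists t s,
      [/\ exec A p s0 t s, L A = [set` t] & G A = decode s].

(* All registers and cells are 0, except that memory cell 0 holds x. *)
Definition init_state (R : realType) (x : R) : state R :=
  State (fun=> 0%N) (update (fun=> 0) 0%N x).

Definition nat_output (R : realType) (s : state R) : nat := reg s 0%N.

(* Register 0 holds the number of closed intervals (points when both ends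
   agree); the endpoints of the i-th one are in memory cells 2i and 2i + 1. *)
Definition set_output (R : realType) (s : state R) : set R :=
  [set x | exists2 i, (i < reg s 0%N)%N & mem s i.*2 <= x <= mem s i.*2.+1].

Definition real_subset (R : realType) (X : set R) : set R[i] :=
  [set x%:C | x in X].

Definition computable_with_error_control (R : realType)
    (Omega : set (input R)) (Xi : input R -> set R[i]) : Prop :=
  exists G : nat -> input R -> set R,
    [/\ forall N, exists p,
          algorithm Omega p (init_state 0) (@set_output R) (G N),
        forall A, Omega A ->
          hausdorff (real_subset (G N A)) (Xi A) @[N --> \oo] --> 0%E &
        exists (p : program) (index : R -> input R -> nat),
          forall e : R, 0 < e ->
            algorithm Omega p (init_state e) (@nat_output R) (index e) /\
            forall A, Omega A ->
              (hausdorff (real_subset (G (index e A) A)) (Xi A) < e%:E)%E].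

(* Main.v *)
Require Import Defs.
From mathcomp Require Import all_boot all_order all_algebra.
From mathcomp Require Import all_classical all_reals all_analysis.
From mathcomp Require Import complex ring lra zify.

Set Implicit Arguments.
Unset Strict Implicit.
Unset Printing Implicit Defensive.

Import Order.TTheory GRing.Theory Num.Theory.
Import numFieldNormedType.Exports.

Local Open Scope classical_set_scope.
Local Open Scope ring_scope.

(** A real x is within delta of the spectrum of the self-adjoint J as soon as
    |(J - x) u| <= delta |u| for some u <> 0, and points of the spectrum admit
    such u for every delta.  Cutting u by all windows of length L and averaging
    yields a vector supported in one window at the cost of an error of order
    L^(-1/2); if the window lies beyond the tail index m, where J is close to
    the free operator, it can be translated to start at m + 1.  So only
    vectors supported in [0, m + 1 + L) matter, and whether one of them
    satisfies |(J - x) u|^2 <= delta^2 |u|^2 is decided by the signs of the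
    pivots of a pentadiagonal matrix.  Testing the points x of a fine grid in
    this way gives the spectrum with an explicit error. *)

(** * Real square-summable sequences *)

(** The spectrum is defined through bounded inverses on complex sequences, whereas the test only
    sees real vectors. As the entries are real, J - (x + iy) is governed by T^2 + y^2 with T = J -
    x, acting separately on real and imaginary parts; where this form is bounded below, an explicit
    iteration inverts it. The obstacle to error control is that finite sections of J may have
    eigenvalues away from the spectrum. The test measures the full image (J - x) u, including the
    row just past the support of u, so every accepted point comes with a genuine trial vector in
    l^2. The converse costs three errors (grid step, window cut, translation); the constants are
    chosen so that together they use 5/8 of the tolerance E^-2. Everything is stated with squares
    because the machine has no square roots. *)

Lemma cvgn_unique (R : realType) (f : nat -> R) (l l' : R) :
  f n @[n --> \oo] --> l -> f n @[n --> \oo] --> l' -> l = l'.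
Proof. by move=> h h'; exact: (cvg_unique (@Rhausdorff R) h h'). Qed.

Section SquareSummable.
Variable R : realType.
Implicit Types (u v w : nat -> R) (a : R).

(** Bounded partial sums instead of convergence: membership is then checked by finite termwise
    estimates, and passes to coordinatewise limits of sequences with a common bound. *)
Definition l2 u : Prop := exists C, forall n, \sum_(k < n) u k ^+ 2 <= C.

Definition dot u v : R := limn (series (fun k => u k * v k)).

Definition lc a u v : nat -> R := fun k => a * u k + v k.

Lemma cvg_seriesP (f : nat -> R) :
  (forall k, 0 <= f k) ->
  (cvgn (series f) <-> exists C, forall n, \sum_(k < n) f k <= C).
Proof.
move=> f0; split.
  move=> cf; exists (limn (series f)) => n.
  have -> : \sum_(k < n) f k = series f n by rewrite seriesEnat /= big_mkord.
  apply: nondecreasing_cvgn_le => //.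
  apply/nondecreasing_seqP => k.
  by rewrite -subr_ge0 !seriesEnat /= big_nat_recr //= addrAC subrr add0r.
move=> [C HC]; apply: nondecreasing_is_cvgn.
  apply/nondecreasing_seqP => k.
  by rewrite -subr_ge0 !seriesEnat /= big_nat_recr //= addrAC subrr add0r.
exists C => _ [n _ <-]; rewrite seriesEnat /= big_mkord; exact: HC.
Qed.

Lemma l2P u : l2 u <-> cvgn (series (fun k => u k ^+ 2)).
Proof. by have [] := @cvg_seriesP (fun k => u k ^+ 2) (fun k => sqr_ge0 _). Qed.

Lemma cvg_dot u v : l2 u -> l2 v ->
  series (fun k => u k * v k) n @[n --> \oo] --> dot u v.
Proof.
move=> [C HC] [D HD].
suff : cvgn (series (fun k => u k * v k)) by [].
apply: normed_cvg.
apply/(cvg_seriesP (f := fun k => `|u k * v k|)) => [k|].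
  exact: normr_ge0.
exists (C + D) => n.
apply: le_trans (lerD (HC n) (HD n)); rewrite -big_split /=.
apply: ler_sum => k _; rewrite normrM -(real_normK (num_real (u k))).
rewrite -(real_normK (num_real (v k))).
have := normr_ge0 (u k); have := normr_ge0 (v k); nra.
Qed.

Lemma sum_cvg_dot u v : l2 u -> l2 v ->
  \sum_(k < n) u k * v k @[n --> \oo] --> dot u v.
Proof.
move=> hu hv.
have -> : (fun n => \sum_(k < n) u k * v k) = series (fun k => u k * v k).
  by apply/funext => n; rewrite seriesEnat /= big_mkord.
exact: cvg_dot.
Qed.

Lemma dotC u v : dot u v = dot v u.
Proof.
rewrite /dot; congr (limn (series _)); apply/funext => k; exact: mulrC.
Qed.

Lemma l2_lc a u v : l2 u -> l2 v -> l2 (lc a u v).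
Proof.
move=> [C HC] [D HD]; exists (2 * (a ^+ 2 * C) + 2 * D) => n.
have : 2 * (a ^+ 2 * \sum_(k < n) u k ^+ 2) + 2 * \sum_(k < n) v k ^+ 2
   <= 2 * (a ^+ 2 * C) + 2 * D.
  have := HC n; have := HD n; have := sqr_ge0 a; nra.
apply: le_trans; rewrite !mulr_sumr -big_split /=; apply: ler_sum => k _.
rewrite /lc; have := sqr_ge0 (a * u k - v k); nra.
Qed.

Arguments l2_lc a [u v].

Lemma dot_lcl a u v w : l2 u -> l2 v -> l2 w ->
  dot (lc a u v) w = a * dot u w + dot v w.
Proof.
move=> hu hv hw; apply: (cvgn_unique (sum_cvg_dot (l2_lc a hu hv) hw)).
have -> : (fun n => \sum_(k < n) lc a u v k * w k) =
   (fun n => a * (\sum_(k < n) u k * w k) + \sum_(k < n) v k * w k).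
  apply/funext => n; rewrite mulr_sumr -big_split /=; apply: eq_bigr => k _.
  by rewrite /lc; ring.
apply: cvgD; last exact: sum_cvg_dot.
by apply: cvgM; [exact: cvg_cst | exact: sum_cvg_dot].
Qed.

Lemma dot_lcr a u v w : l2 u -> l2 v -> l2 w ->
  dot w (lc a u v) = a * dot w u + dot w v.
Proof. by move=> hu hv hw; rewrite !(dotC w) dot_lcl. Qed.

Lemma sum_le_dot u n : l2 u -> \sum_(k < n) u k ^+ 2 <= dot u u.
Proof.
move=> hu; have -> : \sum_(k < n) u k ^+ 2 = series (fun k => u k * u k) n.
  by rewrite seriesEnat /= big_mkord; apply: eq_bigr => k _; rewrite expr2.
apply: nondecreasing_cvgn_le; last by apply: cvgP; exact: cvg_dot.
apply/nondecreasing_seqP => k.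
rewrite -subr_ge0 !seriesEnat /= big_nat_recr //= addrAC subrr add0r.
by rewrite -expr2 sqr_ge0.
Qed.

Lemma dot_le u C : l2 u -> (forall n, \sum_(k < n) u k ^+ 2 <= C) ->
  dot u u <= C.
Proof.
move=> hu H; apply: limr_le; first by apply: cvgP; exact: cvg_dot.
near=> n; rewrite seriesEnat /= big_mkord.
by have := H n; under eq_bigr do rewrite expr2.
Unshelve. all: by end_near. Qed.

Lemma dot_ge0 u : l2 u -> 0 <= dot u u.
Proof. by move=> hu; have := sum_le_dot 0 hu; rewrite big_ord0. Qed.

Lemma coord_le_dot u i : l2 u -> u i ^+ 2 <= dot u u.
Proof.
move=> hu; apply: le_trans (sum_le_dot i.+1 hu).
by rewrite big_ord_recr /= lerDr; apply: sumr_ge0 => k _; exact: sqr_ge0.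
Qed.

Lemma dot_gt0 u i : l2 u -> u i != 0 -> 0 < dot u u.
Proof.
by move=> hu ui; apply: lt_le_trans (coord_le_dot i hu); rewrite exprn_even_gt0.
Qed.

Lemma dot_lc a u v : l2 u -> l2 v ->
  dot (lc a u v) (lc a u v) = a ^+ 2 * dot u u + 2 * a * dot u v + dot v v.
Proof.
move=> hu hv; rewrite dot_lcl ?dot_lcr //; first by rewrite (dotC v u); ring.
exact: l2_lc.
Qed.

Lemma dot_lc_le a u v : l2 u -> l2 v ->
  dot (lc a u v) (lc a u v) <= 2 * a ^+ 2 * dot u u + 2 * dot v v.
Proof.
move=> hu hv; have := dot_ge0 (l2_lc (- a) hu hv).
by rewrite !dot_lc //; nra.
Qed.

Lemma cauchy_schwarz u v : l2 u -> l2 v -> dot u v ^+ 2 <= dot u u * dot v v.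
Proof.
move=> hu hv; have [u0|u0] := ltP 0 (dot u u).
  have := dot_ge0 (l2_lc (- (dot u v / dot u u)) hu hv); rewrite dot_lc //.
  have -> : (- (dot u v / dot u u)) ^+ 2 * dot u u +
     2 * - (dot u v / dot u u) * dot u v + dot v v
     = (dot u u * dot v v - dot u v ^+ 2) / dot u u.
    by field; rewrite gt_eqF.
  by rewrite pmulr_lge0 ?invr_gt0 // subr_ge0.
have uu : dot u u = 0 by apply: le_anti; rewrite u0 dot_ge0.
rewrite uu mul0r.
have u_eq0 k : u k = 0.
  apply/eqP; rewrite -sqrf_eq0; apply/eqP/le_anti.
  by rewrite sqr_ge0 -uu coord_le_dot.
suff -> : dot u v = 0 by rewrite expr0n.
apply: (cvgn_unique (sum_cvg_dot hu hv)).
have -> : (fun n => \sum_(k < n) u k * v k) = (fun=> 0).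
  by apply/funext => n; rewrite big1 // => k _; rewrite u_eq0 mul0r.
exact: cvg_cst.
Qed.

Lemma l2_cvg0 u : l2 u -> u n @[n --> \oo] --> (0 : R).
Proof.
move=> hu; have h : (fun n => u n ^+ 2) @ \oo --> (0 : R).
  exact/cvg_series_cvg_0/l2P.
apply/norm_cvg0P; have -> : (fun n => `|u n|) = (fun n => Num.sqrt (u n ^+ 2)).
  by apply/funext => n; rewrite sqrtr_sqr.
rewrite -(sqrtr0 R).
exact: (continuous_cvg _ (@sqrt_continuous R 0)).
Qed.

End SquareSummable.

Arguments l2_lc {R} a [u v].
(** * Real Jacobi matrices *)

Section RealJacobi.
Variable R : realType.
Implicit Types (a b u v w : nat -> R) (c x : R).

(** Row 0 has no left neighbour, hence the case distinction. This is the action of [jacobi_op] on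
    real and imaginary parts, see [jacobi_opE_jac]. *)
Definition jac a b u : nat -> R := fun i =>
  (if i is i'.+1 then b i' * u i' else 0) + a i * u i + b i * u i.+1.

Definition bounded_by c a := forall k, `|a k| <= c.

Lemma bounded_byP c a k : bounded_by c a -> a k ^+ 2 <= c ^+ 2.
Proof.
move=> h; rewrite -(real_normK (num_real (a k))).
by rewrite ler_sqr ?nnegrE //; apply: le_trans (h k).
Qed.

Lemma jac_lc a b c u v : jac a b (lc c u v) = lc c (jac a b u) (jac a b v).
Proof. by apply/funext => -[|i]; rewrite /jac /lc; ring. Qed.

Lemma jac_shift a b x u : jac (fun k => a k - x) b u = lc (- x) u (jac a b u).
Proof. by apply/funext => -[|i]; rewrite /jac /lc; ring. Qed.

Lemma sum_shift_le (f : nat -> R) n : (forall k, 0 <= f k) ->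
  \sum_(k < n) f k.+1 <= \sum_(k < n.+1) f k.
Proof. by move=> f0; rewrite big_ord_recl /= lerDr. Qed.

Lemma sum_pred_le (f : nat -> R) n : (forall k, 0 <= f k) ->
  \sum_(k < n) (if nat_of_ord k is k'.+1 then f k' else 0)
    <= \sum_(k < n) f k.
Proof.
move=> f0; case: n => [|n]; first by rewrite !big_ord0.
rewrite big_ord_recl /= add0r big_ord_recr /=.
by rewrite lerDl.
Qed.

Section Bounded.
Variables (M : R) (a b : nat -> R).
Hypotheses (aM : bounded_by M a) (bM : bounded_by M b).

(** One factor 3 comes from squaring a sum of three terms, the other from each [u k] occurring in at
    most three rows. *)
Lemma jac_sum_le u C : (forall n, \sum_(k < n) u k ^+ 2 <= C) ->
  forall n, \sum_(k < n) jac a b u k ^+ 2 <= 9 * M ^+ 2 * C.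
Proof.
move=> H n.
pose f k := u k ^+ 2; have f0 k : 0 <= f k by exact: sqr_ge0.
apply: (@le_trans _ _ (\sum_(k < n) 3 * M ^+ 2 *
   ((if nat_of_ord k is k'.+1 then f k' else 0) + f k + f k.+1))).
  apply: ler_sum => -[i _] _ /=; rewrite /jac /f.
  have key p q r y z t : p ^+ 2 <= M ^+ 2 -> q ^+ 2 <= M ^+ 2 ->
      r ^+ 2 <= M ^+ 2 -> (p * y + q * z + r * t) ^+ 2 <=
      3 * M ^+ 2 * (y ^+ 2 + z ^+ 2 + t ^+ 2).
    move=> hp hq hr; apply: (@le_trans _ _
      (3 * (p ^+ 2 * y ^+ 2 + q ^+ 2 * z ^+ 2 + r ^+ 2 * t ^+ 2))).
      rewrite -!exprMn; have := sqr_ge0 (p * y - q * z).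
      have := sqr_ge0 (p * y - r * t); have := sqr_ge0 (q * z - r * t); lra.
    have := sqr_ge0 y; have := sqr_ge0 z; have := sqr_ge0 t; nra.
  case: i => [|i].
    have := key 0 (a 0%N) (b 0%N) 0 (u 0%N) (u 1%N).
    rewrite mul0r expr0n /=; apply; [exact: sqr_ge0|exact: bounded_byP..].
  by apply: key; exact: bounded_byP.
rewrite -mulr_sumr !big_split /=.
have h1 := H n; have h2 := le_trans (sum_shift_le n f0) (H n.+1).
have h3 := le_trans (sum_pred_le n f0) (H n).
rewrite /f in h1 h2 h3 *.
have := sqr_ge0 M; nra.
Qed.

Lemma l2_jac u : l2 u -> l2 (jac a b u).
Proof.
move=> hu; exists (9 * M ^+ 2 * dot u u).
by apply: jac_sum_le => n; exact: sum_le_dot.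
Qed.

Lemma dot_jac_le u : l2 u ->
  dot (jac a b u) (jac a b u) <= 9 * M ^+ 2 * dot u u.
Proof.
move=> hu; apply: dot_le; first exact: l2_jac.
by apply: jac_sum_le => n; exact: sum_le_dot.
Qed.

(* Summation by parts leaves a single boundary term, which tends to 0. *)
Lemma dot_jac_sym u v : l2 u -> l2 v -> dot (jac a b u) v = dot u (jac a b v).
Proof.
move=> hu hv.
have h1 := sum_cvg_dot (l2_jac hu) hv; have h2 := sum_cvg_dot hu (l2_jac hv).
apply/eqP; rewrite -subr_eq0; apply/eqP.
apply: (cvgn_unique (cvgB h1 h2)); rewrite /GRing.sub_fun /=.
have bd n : \sum_(k < n.+1) jac a b u k * v k -
   \sum_(k < n.+1) u k * jac a b v k = b n * (u n.+1 * v n - u n * v n.+1).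
  elim: n => [|n IH]; first by rewrite !big_ord1 /jac /=; ring.
  rewrite big_ord_recr [X in _ - X]big_ord_recr /= opprD addrACA IH /=.
  by rewrite /jac /=; ring.
rewrite -(cvg_shiftS _); under eq_fun do rewrite bd.
have u0 := l2_cvg0 hu; have v0 := l2_cvg0 hv.
have u1 : u n.+1 @[n --> \oo] --> (0 : R) by rewrite (cvg_shiftS u).
have v1 : v n.+1 @[n --> \oo] --> (0 : R) by rewrite (cvg_shiftS v).
have : M * (`|u n.+1| * `|v n| + `|u n| * `|v n.+1|) @[n --> \oo] -->
    M * (`|0 : R| * `|0 : R| + `|0 : R| * `|0 : R|).
  apply: cvgM; first exact: cvg_cst.
  by apply: cvgD; apply: cvgM; exact: cvg_norm.
rewrite normr0 mul0r addr0 mulr0 => h.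
apply/norm_cvg0P; apply: (squeeze_cvgr _ (@cvg_cst _ (0 : R) _ _ _) h).
near=> n; rewrite normr_ge0 /= normrM.
apply: ler_pM => //.
by rewrite -!normrM; exact: ler_normB.
Unshelve. all: by end_near. Qed.

End Bounded.

Lemma bounded_shift M a x : bounded_by M a ->
  bounded_by (M + `|x|) (fun k => a k - x).
Proof. by move=> h k; apply: le_trans (ler_normB _ _) _; rewrite lerD2r. Qed.

Lemma bounded_weak M M' a : M <= M' -> bounded_by M a -> bounded_by M' a.
Proof. by move=> h ha k; apply: le_trans h. Qed.

Definition fin_supp n u := forall k, (n <= k)%N -> u k = 0.

Lemma fin_supp_sum n m u : fin_supp n u -> (n <= m)%N ->
  \sum_(k < m) u k ^+ 2 = \sum_(k < n) u k ^+ 2.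
Proof.
move=> hu nm; rewrite -(subnKC nm) big_split_ord /= [X in _ + X]big1 ?addr0 //.
by move=> i _; rewrite hu ?leq_addr // expr0n.
Qed.

Lemma fin_supp_jac n a b u : fin_supp n u -> fin_supp n.+1 (jac a b u).
Proof.
move=> h [//|k] nk; rewrite /jac !h ?mulr0 ?addr0 //; lia.
Qed.

Lemma fin_supp_sum_le n m u : fin_supp n u ->
  \sum_(k < m) u k ^+ 2 <= \sum_(k < n) u k ^+ 2.
Proof.
move=> h; have [mn|nm] := leqP m n; last by rewrite (fin_supp_sum h (ltnW nm)).
rewrite -(subnKC mn) big_split_ord /= lerDl.
by apply: sumr_ge0 => i _; exact: sqr_ge0.
Qed.

Lemma fin_supp_l2 n u : fin_supp n u -> l2 u.
Proof.
by move=> h; eexists => m; exact: (fin_supp_sum_le m h).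
Qed.

Lemma fin_supp_dot n u : fin_supp n u -> dot u u = \sum_(k < n) u k ^+ 2.
Proof.
move=> h; have hu := fin_supp_l2 h; apply/le_anti/andP; split.
  by apply: dot_le => // m; exact: fin_supp_sum_le.
exact: sum_le_dot.
Qed.

End RealJacobi.
(** * Solving coercive equations *)

Section Coercive.
Variables (R : realType) (M : R) (a b : nat -> R) (y : R).
Hypotheses (aM : bounded_by M a) (bM : bounded_by M b).
Implicit Types (u v w : nat -> R) (c : R).

Definition jac_sq a b y u := lc (y ^+ 2) u (jac a b (jac a b u)).
Local Notation T := (jac a b).
Local Notation P := (jac_sq a b y).

Let l2T u : l2 u -> l2 (T u). Proof. by move=> hu; exact: (l2_jac aM bM hu). Qed.

Lemma jac_sq_lc c u v : P (lc c u v) = lc c (P u) (P v).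
Proof. by rewrite /jac_sq !jac_lc; apply/funext => k; rewrite /lc; ring. Qed.

Lemma l2_jac_sq u : l2 u -> l2 (P u).
Proof. by move=> hu; apply: l2_lc => //; exact/l2T/l2T. Qed.

Lemma dot_jac_sq u v : l2 u -> l2 v ->
  dot (P u) v = y ^+ 2 * dot u v + dot (T u) (T v).
Proof.
move=> hu hv; rewrite dot_lcl //; last exact/l2T/l2T.
by rewrite (dot_jac_sym aM bM) //; exact: l2T.
Qed.

Lemma jac_sq_bounded u : l2 u ->
  dot (P u) (P u) <= (2 * y ^+ 4 + 162 * M ^+ 4 + 1) * dot u u.
Proof.
move=> hu; apply: le_trans (dot_lc_le _ hu (l2T (l2T hu))) _.
have h1 := dot_jac_le aM bM hu; have h2 := dot_jac_le aM bM (l2T hu).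
have h0 := dot_ge0 hu; have M0 := sqr_ge0 M.
have : 9 * M ^+ 2 * dot (T u) (T u) <= 9 * M ^+ 2 * (9 * M ^+ 2 * dot u u).
  by apply: ler_wpM2l => //; lra.
nra.
Qed.

Definition coercive c := forall u, l2 u ->
  c * dot u u <= dot (T u) (T u) + y ^+ 2 * dot u u.

Section Solve.
Variable c : R.
Hypotheses (c0 : 0 < c) (hc : coercive c).
Variable v : nat -> R.
Hypothesis hv : l2 v.

(** Richardson iteration for P w = v: [w n] are the iterates and [r n] the residuals v - P (w n).
    Coercivity and |P r|^2 <= B |r|^2 give |r - tau P r|^2 <= (1 - 2 tau c + tau^2 B) |r|^2, and tau
    = c / B turns the factor into [rho]. The summand c^2 in [B] keeps [rho] positive. *)
Let B := 2 * y ^+ 4 + 162 * M ^+ 4 + 1 + c ^+ 2.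
Let tau := c / B.
Let rho := 1 - c ^+ 2 / B.
Let r n := iter n (fun u => lc (- tau) (P u) u) v.
Let w n := fun k => tau * \sum_(i < n) r i k.

Let B_gt : c ^+ 2 < B.
Proof.
rewrite /B; have := sqr_ge0 (y ^+ 2); have := sqr_ge0 (M ^+ 2).
rewrite -!exprM; lra.
Qed.

Let B0 : 0 < B. Proof. by apply: le_lt_trans B_gt; exact: sqr_ge0. Qed.

Let rho01 : 0 < rho < 1.
Proof.
rewrite /rho subr_gt0 ltr_pdivrMr // mul1r B_gt /=.
by rewrite ltrBlDr ltrDl divr_gt0 // exprn_gt0.
Qed.

Let l2r n : l2 (r n).
Proof. by elim: n => //= n IH; apply: l2_lc => //; exact: l2_jac_sq. Qed.

Let r_le n : dot (r n) (r n) <= rho ^+ n * dot v v.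
Proof.
elim: n => [|n IH]; first by rewrite expr0 mul1r.
have hP := l2_jac_sq (l2r n).
have -> : r n.+1 = lc (- tau) (P (r n)) (r n) by [].
rewrite dot_lc // (exprS rho) -[X in _ <= X]mulrA.
apply: (@le_trans _ _ (rho * dot (r n) (r n))); last first.
  by rewrite ler_pM2l //; case/andP: rho01.
have h1 := hc (l2r n); have h2 := jac_sq_bounded (l2r n).
have h3 := dot_jac_sq (l2r n) (l2r n); have h4 := dot_ge0 (l2r n).
have h1' : c * dot (r n) (r n) <= dot (P (r n)) (r n) by rewrite h3; lra.
have h2' : dot (P (r n)) (P (r n)) <= B * dot (r n) (r n).
  by apply: le_trans h2 _; apply: ler_wpM2r => //; rewrite /B; have := sqr_ge0 c; lra.
have t0 : 0 < tau by rewrite divr_gt0.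
have tB : tau * B = c by rewrite /tau divfK // gt_eqF.
have -> : rho = 1 - tau * c by rewrite /rho /tau; ring.
have : tau ^+ 2 * dot (P (r n)) (P (r n)) <= tau * c * dot (r n) (r n).
  have -> : tau * c * dot (r n) (r n) = tau ^+ 2 * (B * dot (r n) (r n)).
    by rewrite -[in LHS]tB; ring.
  by rewrite ler_wpM2l ?sqr_ge0.
have : tau * (c * dot (r n) (r n)) <= tau * dot (P (r n)) (r n).
  by rewrite ler_pM2l.
rewrite sqrrN; lra.
Qed.

Let r_coord k n : `|r n k| <= Num.sqrt (dot v v) * Num.sqrt rho ^+ n.
Proof.
have /andP[r0 r1] := rho01.
rewrite -sqrtr_sqr.
have -> : Num.sqrt rho ^+ n = Num.sqrt (rho ^+ n).
  elim: n => [|n IH]; first by rewrite !expr0 sqrtr1.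
  by rewrite !exprS sqrtrM ?(ltW r0) // IH.
rewrite mulrC -sqrtrM ?exprn_ge0 ?(ltW r0) // ler_sqrt.
  exact: le_trans (coord_le_dot k (l2r n)) (r_le n).
by rewrite mulr_ge0 ?dot_ge0 // exprn_ge0 // ltW.
Qed.

Let q1 : `|Num.sqrt rho| < 1.
Proof.
have /andP[r0 r1] := rho01.
by rewrite ger0_norm ?sqrtr_ge0 // -sqrtr1 ltr_sqrt.
Qed.

Let r_cvg0 k : r n k @[n --> \oo] --> (0 : R).
Proof.
apply/norm_cvg0P.
apply: (squeeze_cvgr _ (@cvg_cst _ (0 : R) _ _ _) (cvg_geometric (Num.sqrt (dot v v)) q1)).
by near=> n; rewrite normr_ge0 /=; exact: r_coord.
Unshelve. all: by end_near. Qed.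

Let w_cvg k : cvgn (fun n => w n k).
Proof.
suff h : cvgn (series (fun n => r n k)).
  have -> : (fun n => w n k) = (fun n => tau * series (fun n => r n k) n).
    by apply/funext => n; rewrite /w seriesEnat /= big_mkord.
  by apply: is_cvgM => //; exact: is_cvg_cst.
apply: normed_cvg.
apply: (@series_le_cvg _ _ (geometric (Num.sqrt (dot v v)) (Num.sqrt rho))) => [n|n|n|].
- exact: normr_ge0.
- by rewrite /geometric /= mulr_ge0 ?exprn_ge0 ?sqrtr_ge0.
- exact: r_coord.
- exact: is_cvg_geometric_series.
Qed.

Let l2w n : l2 (w n).
Proof.
elim: n => [|n IH].
  exists 0 => m; rewrite big1 // => i _.
  by rewrite /w big_ord0 mulr0 expr0n.
have -> : w n.+1 = lc tau (r n) (w n).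
  by apply/funext => k; rewrite /w /lc big_ord_recr /=; ring.
exact: l2_lc.
Qed.

Let P_w n : P (w n) = lc (- 1) (r n) v.
Proof.
elim: n => [|n IH].
  have -> : w 0 = (fun=> 0) by apply/funext => k; rewrite /w big_ord0 mulr0.
  apply/funext => -[|[|k]]; rewrite /jac_sq /jac /lc /=; ring.
have -> : w n.+1 = lc tau (r n) (w n).
  by apply/funext => k; rewrite /w /lc big_ord_recr /=; ring.
rewrite jac_sq_lc IH; apply/funext => k; rewrite /r /lc /=; rewrite /lc; ring.
Qed.

(** Coercivity and Cauchy-Schwarz give c |w| <= |P w|, and P w = v - r has norm at most 2 |v|. The
    iterates are only shown to converge coordinatewise, so this uniform bound is what puts their
    limit in l^2. *)
Let dot_w n : dot (w n) (w n) <= 4 * dot v v / c ^+ 2.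
Proof.
have hw := l2w n; have hP := l2_jac_sq hw.
have h1 := hc hw; have h2 := dot_jac_sq hw hw.
have h3 := cauchy_schwarz hP hw; have h4 := dot_ge0 hw.
have h5 : dot (P (w n)) (P (w n)) <= 4 * dot v v.
  rewrite P_w; apply: le_trans (dot_lc_le _ (l2r n) hv) _.
  have := r_le n; have /andP[r0 r1] := rho01.
  have : rho ^+ n <= 1 by rewrite exprn_ile1 // ltW.
  have := dot_ge0 hv; have := dot_ge0 (l2r n); nra.
rewrite ler_pdivlMr ?exprn_gt0 //.
have [w0|] := ltP 0 (dot (w n) (w n)); last first.
  have := dot_ge0 hv; have := sqr_ge0 c; nra.
have h6 : c * dot (w n) (w n) <= dot (P (w n)) (w n) by rewrite h2; lra.
have h7 : (c * dot (w n) (w n)) ^+ 2 <= dot (P (w n)) (P (w n)) * dot (w n) (w n).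
  apply: le_trans h3; rewrite ler_sqr ?nnegrE //.
    by rewrite mulr_ge0 // ltW.
  by apply: le_trans h6; rewrite mulr_ge0 // ltW.
have : c ^+ 2 * dot (w n) (w n) <= dot (P (w n)) (P (w n)).
  by rewrite -(ler_pM2r w0); apply: le_trans h7; rewrite expr2; lra.
lra.
Qed.

Lemma solve_coercive : exists2 z, l2 z & P z = v.
Proof.
pose z k := limn (fun n => w n k).
have hz k : w n k @[n --> \oo] --> z k by exact: w_cvg.
exists z.
  exists (4 * dot v v / c ^+ 2) => m.
  have h : \sum_(k < m) w n k ^+ 2 @[n --> \oo] --> \sum_(k < m) z k ^+ 2.
    elim: m => [|m IH].
      by rewrite big_ord0; under eq_fun do rewrite big_ord0; exact: cvg_cst.
    rewrite big_ord_recr /=; under eq_fun do rewrite big_ord_recr /=.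
    by apply: cvgD => //; rewrite expr2; under eq_fun do rewrite expr2; exact: cvgM.
  rewrite -(cvg_lim (@Rhausdorff R) h); apply: limr_le; first exact: cvgP h.
  near=> n; apply: le_trans (dot_w n); exact: sum_le_dot.
(* Each coordinate of [T u] involves at most three coordinates of [u], so coordinatewise convergence
   is enough to pass to the limit in P w = v - r. *)
have lin (u : nat -> nat -> R) l : (forall k, u n k @[n --> \oo] --> l k) ->
    forall k, T (u n) k @[n --> \oo] --> T l k.
  move=> h k; rewrite /jac; apply: cvgD; last first.
    by apply: cvgM => //; exact: cvg_cst.
  apply: cvgD; last by apply: cvgM => //; exact: cvg_cst.
  case: k => [|k]; first exact: cvg_cst.
  by apply: cvgM => //; exact: cvg_cst.
apply/funext => k.
have h1 : P (w n) k @[n --> \oo] --> P z k.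
  rewrite /jac_sq /lc; apply: cvgD; last exact/lin/lin.
  by apply: cvgM => //; exact: cvg_cst.
have h2 : P (w n) k @[n --> \oo] --> v k.
  under eq_fun do rewrite P_w /lc mulN1r addrC.
  have := cvgB (cvg_cst (v k)) (r_cvg0 k); rewrite subr0; exact.
exact: cvgn_unique h1 h2.
Unshelve. all: by end_near. Qed.

End Solve.
End Coercive.
(** * Approximate eigenvalues *)

Section ApproximateEigenvalue.
Variable R : realType.
Implicit Types (a b u : nat -> R) (x c M : R).

(** Weyl's criterion with real trial vectors; [c] bounds the squared ratio of norms. *)
Definition approx_eigenvalue a b x := forall c, 0 < c ->
  exists u, [/\ l2 u, 0 < dot u u &
    dot (jac (fun k => a k - x) b u) (jac (fun k => a k - x) b u)
      < c * dot u u].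

Lemma not_approx_eigenvalue a b x : ~ approx_eigenvalue a b x ->
  exists2 c, 0 < c & forall u, l2 u -> c * dot u u <=
    dot (jac (fun k => a k - x) b u) (jac (fun k => a k - x) b u).
Proof.
move=> /existsNP[c /not_implyP[c0 /forallNP H]]; exists c => // u hu.
rewrite leNgt; apply/negP => h; apply: (H u); split => //.
have [//|u0] := ltP 0 (dot u u).
have uu : dot u u = 0 by apply/le_anti; rewrite u0 dot_ge0.
(* No bound on the entries is available to place the image of [u] in l^2, so [dot_ge0] cannot be
   applied to it. The image of the null vector is computed instead, [lc (- 1) u u] being a way to
   write 0. *)
suff uz : u = lc (- 1) u u.
  move: h; rewrite uu mulr0 ltNge; rewrite [X in jac _ _ X]uz.
  have hz k : u k = 0.
    apply/eqP; rewrite -sqrf_eq0; apply/eqP/le_anti.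
    by rewrite sqr_ge0 -[X in _ <= X]uu coord_le_dot.
  have -> : jac (fun k => a k - x) b (lc (-1) u u) = u.
    apply/funext => -[|k]; rewrite /jac /lc !hz; ring.
  by rewrite uu lexx.
apply/funext => k; rewrite /lc.
suff -> : u k = 0 by ring.
apply/eqP; rewrite -sqrf_eq0; apply/eqP/le_anti.
by rewrite sqr_ge0 -[X in _ <= X]uu coord_le_dot.
Qed.

(* With [s] the infimum of [|Tu|^2 / |u|^2], the form of [T^2 - s] is
   nonnegative with infimum 0, so [(T - sqrt s) (T + sqrt s)] is not bounded
   below, and neither are both factors. *)
Lemma approx_eigenvalue_near M a b u (eta : R) :
  bounded_by M a -> bounded_by M b ->
  l2 u -> 0 < dot u u -> dot (jac a b u) (jac a b u) <= eta * dot u u ->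
  exists2 x, x ^+ 2 <= eta & approx_eigenvalue a b x.
Proof.
move=> aM bM hu u0 hle; set T := jac a b.
pose E := [set r | exists v, [/\ l2 v, 0 < dot v v &
   r = dot (T v) (T v) / dot v v]].
have l2T v : l2 v -> l2 (T v) by exact: (l2_jac aM bM).
have Elb : lbound E 0.
  by move=> _ [v [hv v0 ->]]; rewrite divr_ge0 ?dot_ge0 //; exact: l2T.
have En : E (dot (T u) (T u) / dot u u) by exists u.
have Ei : has_inf E by split; [eexists; exact: En | exists 0].
pose s := inf E.
have s0 : 0 <= s by apply: lb_le_inf => //; eexists; exact: En.
have s_eta : s <= eta.
  apply: le_trans (ge_inf _ En) _; first by exists 0.
  by rewrite ler_pdivrMr.
have s_le v : l2 v -> s * dot v v <= dot (T v) (T v).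
  move=> hv; have [v0|v0] := ltP 0 (dot v v).
    by rewrite -ler_pdivlMr //; apply: ge_inf; [exists 0 | exists v].
  apply: (@le_trans _ _ 0); last exact/dot_ge0/l2T.
  by rewrite mulr_ge0_le0.
pose d := Num.sqrt s; have ds : d ^+ 2 = s by rewrite sqr_sqrtr.
have [h1|/not_approx_eigenvalue[c1 c10 h1]] := pselect (approx_eigenvalue a b d).
  by exists d => //; rewrite ds.
have [h2|/not_approx_eigenvalue[c2 c20 h2]] := pselect (approx_eigenvalue a b (- d)).
  by exists (- d) => //; rewrite sqrrN ds.
pose B := 9 * M ^+ 2 + 1; have B0 : 0 < B by rewrite /B; have := sqr_ge0 M; lra.
pose e := c1 * c2 / (2 * B).
have e0 : 0 < e by rewrite divr_gt0 ?mulr_gt0.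
have [_ [v [hv v0 ->]]] := inf_adherent e0 Ei.
rewrite -/s ltr_pdivrMr // => hvlt; exfalso.
have hTv := l2T _ hv; have hTTv := l2T _ hTv.
pose p := lc (- s) v (T (T v)).
have hp : l2 p by exact: l2_lc.
have hTp := l2T _ hp.
have pE : p = jac (fun k => a k - d) b (jac (fun k => a k - - d) b v).
  rewrite 2!jac_shift jac_lc; apply/funext => k; rewrite /p /lc -ds /T; ring.
have p_ge : c1 * (c2 * dot v v) <= dot p p.
  have hq : l2 (jac (fun k => a k - - d) b v).
    by rewrite jac_shift; apply: l2_lc.
  rewrite pE; apply: le_trans (h1 _ hq).
  by rewrite ler_pM2l //; exact: h2.
(* Testing the minimality of [s] at v - p / B, one gradient step from the near-minimiser [v], yields
   |p|^2 / B < e |v|^2, because [B] dominates |T|^2. The choice of [e] makes [p_ge] say |p|^2 / B >=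
   2 e |v|^2, a contradiction. *)
have hz := l2_lc (- B^-1) hp hv.
have := s_le _ hz; rewrite /T jac_lc -/T (dot_lc _ hp hv) (dot_lc _ hTp hTv).
have -> : dot (T p) (T v) = dot p p + s * dot p v.
  rewrite (dot_jac_sym aM bM hp hTv) -/T.
  have -> : T (T v) = lc s v p by apply/funext => k; rewrite /p /lc; ring.
  by rewrite dot_lcr //; ring.
have hTpp := dot_jac_le aM bM hp; rewrite -/T in hTpp.
have hpp := dot_ge0 hp.
set t := B^-1; have t0 : 0 < t by rewrite invr_gt0.
have tB : t * B = 1 by rewrite mulVf // gt_eqF.
have : t ^+ 2 * dot (T p) (T p) <= t * dot p p.
  have -> : t * dot p p = t ^+ 2 * (B * dot p p).
    by rewrite mulrA expr2 -(mulrA t t) tB mulr1.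
  rewrite ler_wpM2l ?sqr_ge0 //; rewrite /B; lra.
have := mulr_ge0 (sqr_ge0 t) (mulr_ge0 s0 hpp).
have ev : t * (c1 * c2) = 2 * e by rewrite /e /t; field; rewrite gt_eqF.
have : t * (c1 * (c2 * dot v v)) <= t * dot p p by rewrite ler_pM2l.
have -> : t * (c1 * (c2 * dot v v)) = 2 * (e * dot v v) by rewrite [RHS]mulrA -ev; ring.
have := mulr_gt0 e0 v0.
rewrite sqrrN; lra.
Qed.

End ApproximateEigenvalue.
(** * Localisation to a finite window *)

Section Windows.
Variable R : realType.
Implicit Types (a b u w : nat -> R).

Lemma window_count (N L k : nat) (x : R) :
  \sum_(t < N) (if (k < t <= k + L)%N then x else 0)
    = (minn (N.-1 - k) L)%:R * x.
Proof.
elim: N => [|N IH]; first by rewrite big_ord0 sub0n min0n mul0r.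
rewrite big_ord_recr /= IH; case: (boolP (k < N <= k + L)%N) => h.
  have -> : minn (N - k) L = (minn (N.-1 - k) L).+1 by lia.
  by rewrite -natr1; ring.
have -> : minn (N - k) L = minn (N.-1 - k) L by lia.
by rewrite addr0.
Qed.

Lemma boundary_count (N j : nat) : \sum_(t < N) (nat_of_ord t == j)%:R <= 1 :> R.
Proof.
suff : \sum_(t < N) (nat_of_ord t == j)%:R = (j < N)%N%:R :> R.
  by move=> ->; case: (j < N)%N.
elim: N => [|N IH]; first by rewrite big_ord0.
rewrite big_ord_recr /= IH ltnS [(j <= N)%N]leq_eqVlt eq_sym.
by case: eqP => [->|_]; rewrite ?ltnn ?add0r ?addr0.
Qed.

(** Indexed by its excluded right end: windows sticking out to the left of 0 are then included, and
    every site lies in exactly [L] windows. *)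
Definition window (L t : nat) u : nat -> R :=
  fun k => if (k < t <= k + L)%N then u k else 0.

Lemma fin_supp_window L t u : fin_supp t (window L t u).
Proof. by move=> k tk; rewrite /window; case: ifP => //; lia. Qed.

Section Localisation.
Variables (M : R) (a b u : nat -> R) (L : nat).
Hypotheses (bM : bounded_by M b).
Local Notation T := (jac a b).
Let f k := u k ^+ 2.
Let prev (g : nat -> R) i := if i is i'.+1 then g i' else 0.
Let edge i t : R := (t == i.+1)%:R + (t == (i + L).+1)%:R.

Let f0 k : 0 <= f k. Proof. exact: sqr_ge0. Qed.

(* Neighbouring sites are separated only by the windows with an end between
   them, so the commutator of [T] with the cutoff is supported on edges. *)
Let jac_window_le t i : jac a b (window L t u) i ^+ 2 <=
  2 * (if (i < t <= i + L)%N then T u i ^+ 2 else 0) +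
  4 * M ^+ 2 * (prev (fun k => edge k t * f k) i + edge i t * f i.+1).
Proof.
pose X i : R := if (i < t <= i + L)%N then 1 else 0.
have XE k : window L t u k = X k * u k.
  by rewrite /window /X; case: ifP; rewrite ?mul1r ?mul0r.
have -> : (if (i < t <= i + L)%N then T u i ^+ 2 else 0) = (X i * T u i) ^+ 2.
  by rewrite /X; case: ifP; rewrite ?mul1r ?mul0r ?expr0n.
have diff k : (X k - X k.+1) ^+ 2 <= edge k t.
  rewrite /X /edge; case: eqP => h1; case: eqP => h2; do 2 case: ifP => ? //=;
  rewrite ?subrr ?subr0 ?sub0r ?sqrrN ?expr1n ?expr0n //=; try lia; lra.
have key p q y z d e : p ^+ 2 <= M ^+ 2 -> q ^+ 2 <= M ^+ 2 ->
    y ^+ 2 <= d -> z ^+ 2 <= e -> forall s v v', (s + p * v * y + q * v' * z) ^+ 2 <=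
    2 * s ^+ 2 + 4 * M ^+ 2 * (d * v ^+ 2 + e * v' ^+ 2).
  move=> hp hq hy hz s v v'.
  have aux (p' y' d' x : R) : p' ^+ 2 <= M ^+ 2 -> y' ^+ 2 <= d' ->
      (p' * x * y') ^+ 2 <= M ^+ 2 * (d' * x ^+ 2).
    move=> h1 h2; have -> : (p' * x * y') ^+ 2 = p' ^+ 2 * (y' ^+ 2 * x ^+ 2) by ring.
    apply: ler_pM; rewrite ?(mulr_ge0 (sqr_ge0 _) (sqr_ge0 _)) ?sqr_ge0 //.
    by apply: ler_wpM2r => //; exact: sqr_ge0.
  have := aux _ _ _ v hp hy; have := aux _ _ _ v' hq hz.
  have := sqr_ge0 (s - p * v * y - q * v' * z).
  have := sqr_ge0 (p * v * y - q * v' * z); nra.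
case: i => [|i]; rewrite /jac !XE /prev.
  have -> : (0 + a 0%N * (X 0%N * u 0%N) + b 0%N * (X 1%N * u 1%N)) =
    X 0%N * (0 + a 0%N * u 0%N + b 0%N * u 1%N) + 0 * 0 * 0
     + b 0%N * u 1%N * (X 1%N - X 0%N) by ring.
  apply: le_trans (key _ _ _ _ 0 (edge 0 t) _ _ _ _ _ _ _) _.
  - by rewrite expr0n sqr_ge0.
  - exact: bounded_byP.
  - by rewrite expr0n.
  - by rewrite -sqrrN opprB.
  - by rewrite mul0r.
have -> : b i * (X i * u i) + a i.+1 * (X i.+1 * u i.+1) +
    b i.+1 * (X i.+2 * u i.+2) =
    X i.+1 * (b i * u i + a i.+1 * u i.+1 + b i.+1 * u i.+2)
    + b i * u i * (X i - X i.+1) + b i.+1 * u i.+2 * (X i.+2 - X i.+1) by ring.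
apply: key; [exact: bounded_byP|exact: bounded_byP|exact: diff|].
by rewrite -sqrrN opprB; exact: diff.
Qed.

Let sum_edge N i : \sum_(t < N) edge i t <= 2.
Proof.
rewrite /edge big_split /=.
have := boundary_count N i.+1; have := boundary_count N (i + L).+1; lra.
Qed.

(** After exchanging the sums, each row occurs in at most [L] windows while each edge is cut by at
    most two, so the main term grows with [L] and the commutator error does not. The diagonal
    commutes with the cutoff; hence only the bound on [b] enters, and the constants are the same for
    every shift J - y. *)
Let sum_windows_le N : l2 u -> l2 (T u) ->
  \sum_(t < N) \sum_(i < N.+1) T (window L t u) i ^+ 2 <=
  2 * L%:R * dot (T u) (T u) + 16 * M ^+ 2 * dot u u.
Proof.
move=> hu hTu; rewrite exchange_big /=.
apply: (@le_trans _ _ (\sum_(i < N.+1) (2 * L%:R * T u i ^+ 2 +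
   8 * M ^+ 2 * (prev f i + f i.+1)))); last first.
  rewrite big_split /= -!mulr_sumr big_split /=.
  have h1 := sum_le_dot N.+1 hTu; have h2 := sum_le_dot N.+2 hu.
  have h3 := sum_le_dot N.+1 hu.
  have := le_trans (sum_shift_le N.+1 f0) h2.
  have := le_trans (sum_pred_le N.+1 f0) h3.
  have := sqr_ge0 M; have := ler0n R L; rewrite /prev; nra.
apply: ler_sum => i _; apply: (@le_trans _ _ (\sum_(t < N)
   (2 * (if (i < t <= i + L)%N then T u i ^+ 2 else 0) + 4 * M ^+ 2 *
    (prev (fun k => edge k t * f k) i + edge i t * f i.+1)))).
  by apply: ler_sum => t _; exact: jac_window_le.
rewrite big_split /= -!mulr_sumr window_count big_split /=.
have hM : (minn (N.-1 - i) L)%:R <= L%:R :> R by rewrite ler_nat geq_minr.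
have := ler_wpM2r (sqr_ge0 (T u i)) hM.
have : \sum_(t < N) edge i t * f i.+1 <= 2 * f i.+1.
  by rewrite -mulr_suml; exact: (ler_wpM2r (f0 _) (sum_edge N _)).
have : \sum_(t < N) prev (fun k => edge k t * f k) i <= 2 * prev f i.
  case: (nat_of_ord i) => [|k] /=; first by rewrite sumr_const mul0rn mulr0.
  by rewrite -mulr_suml; exact: (ler_wpM2r (f0 _) (sum_edge N _)).
have := sqr_ge0 M; nra.
Qed.

(** If every window violated the conclusion, summation would give 32 M^2 |u|^2 <= 2 L |Tu|^2 + 16
    M^2 |u|^2, whereas the hypothesis makes 2 L |Tu|^2 smaller than 16 M^2 |u|^2. *)
Lemma window_localisation :
  0 < M -> (0 < L)%N -> l2 u -> l2 (T u) -> 0 < dot u u ->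
  dot (T u) (T u) < (8 * M ^+ 2 / L%:R) * dot u u ->
  exists t, 0 < dot (window L t u) (window L t u) /\
    dot (T (window L t u)) (T (window L t u)) <=
      (32 * M ^+ 2 / L%:R) * dot (window L t u) (window L t u).
Proof.
move=> M0 L0 hu hTu u0 hlt; set kap := 32 * M ^+ 2 / L%:R.
have LR : 0 < L%:R :> R by rewrite ltr0n.
have kapL : kap * L%:R = 32 * M ^+ 2 by rewrite /kap divfK // gt_eqF.
have kap0 : 0 < kap by rewrite divr_gt0 // mulr_gt0 // exprn_gt0.
apply: contrapT => /forallNP H.
have hw t := fin_supp_l2 (@fin_supp_window L t u).
have hTw t := fin_supp_jac a b (@fin_supp_window L t u).
have {}H t : kap * dot (window L t u) (window L t u) <=
    dot (T (window L t u)) (T (window L t u)).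
  have [w0|w0] := ltP 0 (dot (window L t u) (window L t u)); last first.
    apply: (@le_trans _ _ 0); last exact: dot_ge0 (fin_supp_l2 (hTw t)).
    by rewrite pmulr_rle0.
  by rewrite leNgt; apply/negP => h; apply: (H t); split=> //; exact: ltW.
suff : kap * L%:R * dot u u <= 2 * L%:R * dot (T u) (T u) + 16 * M ^+ 2 * dot u u.
  rewrite kapL.
  have : L%:R * dot (T u) (T u) < 8 * M ^+ 2 * dot u u.
    have -> : 8 * M ^+ 2 * dot u u = L%:R * (8 * M ^+ 2 / L%:R * dot u u).
      by field; rewrite gt_eqF.
    by rewrite ltr_pM2l.
  lra.
have kL0 : 0 < kap * L%:R by exact: mulr_gt0.
rewrite mulrC -ler_pdivlMr //; apply: dot_le => // K.
rewrite ler_pdivlMr //.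
(* Every site below [K] lies in exactly [L] of the windows with t <= K + L, so these recover [L]
   times the partial sum. *)
apply: le_trans (sum_windows_le (K + L).+1 hu hTu).
have -> : (\sum_(k < K) u k ^+ 2) * (kap * L%:R) =
    \sum_(t < (K + L).+1) kap * \sum_(k < K) window L t u k ^+ 2.
  rewrite -mulr_sumr exchange_big /= mulrC -mulrA; congr (_ * _).
  rewrite mulr_sumr; apply: eq_bigr => k _.
  have -> : L%:R = (minn ((K + L).+1.-1 - k) L)%:R :> R.
    by congr (_%:R); have := ltn_ord k; lia.
  rewrite -window_count; apply: eq_bigr => t _; rewrite /window.
  by case: ifP => //; rewrite expr0n.
apply: ler_sum => t _; apply: le_trans (_ : _ <= kap * dot (window L t u) (window L t u)) _.
  by rewrite ler_pM2l //; apply: sum_le_dot.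
apply: le_trans (H t) _; rewrite (fin_supp_dot (hTw t)).
by rewrite -(fin_supp_sum (hTw t) (_ : _ <= (K + L).+2)%N) //; exact/leqW/ltn_ord.
Qed.

End Localisation.

(* Beyond [m] the coefficients are nearly constant, so a vector living there
   can be translated to start at [m.+1]. *)
Lemma shift_window a b (e : R) (m L t : nat) w :
  (forall i j, (m <= i)%N -> (m <= j)%N -> `|a i - a j| <= e) ->
  (forall i j, (m <= i)%N -> (m <= j)%N -> `|b i - b j| <= e) ->
  (forall k, w k != 0 -> (k < t <= k + L)%N) ->
  exists w', [/\ fin_supp (m.+1 + L) w', dot w' w' = dot w w &
    dot (jac a b w') (jac a b w') <=
      2 * dot (jac a b w) (jac a b w) + 18 * e ^+ 2 * dot w w].
Proof.
move=> ae be hw.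
have wz k : ~~ (k < t <= k + L)%N -> w k = 0 by move=> h; apply: contraNeq h; exact: hw.
have fw : fin_supp t w by move=> k tk; apply: wz; lia.
have fTw := fin_supp_jac a b fw.
have l2w := fin_supp_l2 fw; have l2Tw := fin_supp_l2 fTw.
have [tn|nt] := leqP t (m.+1 + L).
  exists w; split => //; first by move=> k nk; apply: fw; lia.
  have := dot_ge0 l2w; have := dot_ge0 l2Tw; have := sqr_ge0 e; nra.
(* The translated window starts at m + 1 and not at m: row m - 1 would otherwise meet the
   coefficient b_(m-1), which the tail hypothesis does not control. *)
pose r := (t - (m.+1 + L))%N.
pose w' k := if (k <= m)%N then 0 else w (k + r)%N.
have fw' : fin_supp (m.+1 + L) w'.
  by move=> k nk; rewrite /w'; case: ifP => // _; apply: fw; rewrite /r; lia.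
have fTw' := fin_supp_jac a b fw'.
have dw : dot w' w' = dot w w.
  rewrite (fin_supp_dot fw') (fin_supp_dot fw).
  have -> : t = ((m.+1 + r) + L)%N by rewrite /r; lia.
  rewrite [LHS]big_split_ord [RHS]big_split_ord /= big1 => [|i _]; last first.
    by rewrite /w' -ltnS ltn_ord expr0n.
  rewrite [X in _ = X + _]big1 => [|i _]; last first.
    by rewrite wz ?expr0n //; have := ltn_ord i; rewrite /r; lia.
  congr (_ + _); apply: eq_bigr => i _.
  have -> : w' (m.+1 + i)%N = w (m.+1 + i + r)%N.
    by rewrite /w'; case: ifP => //; lia.
  by congr (w _ ^+ 2); lia.
exists w'; split => //; rewrite (fin_supp_dot fTw').
pose f k := w' k ^+ 2; have f0 k : 0 <= f k by exact: sqr_ge0.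
pose n := (m.+1 + L).+1.
have pt (i : nat) : jac a b w' i ^+ 2 <= 2 * jac a b w (i + r)%N ^+ 2 +
   6 * e ^+ 2 * ((if i is i'.+1 then f i' else 0) + f i + f i.+1).
  have [im|mi] := ltnP i m.
    have -> : jac a b w' i = 0.
      have wm k : (k <= m)%N -> w' k = 0 by rewrite /w' => ->.
      by case: i im => [|i] im; rewrite /jac !wm ?mulr0 ?addr0 //; lia.
    rewrite expr0n /=; apply: addr_ge0; first by rewrite mulr_ge0 ?sqr_ge0.
    apply: mulr_ge0; first by rewrite mulr_ge0 ?sqr_ge0.
    by apply: addr_ge0 => //; apply: addr_ge0 => //; case: (i).
  have key p q s x y z d : (`|p| <= e \/ x = 0) -> (`|q| <= e \/ y = 0) ->
      `|s| <= e -> (d + (p * x + q * y + s * z)) ^+ 2 <=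
      2 * d ^+ 2 + 6 * e ^+ 2 * (x ^+ 2 + y ^+ 2 + z ^+ 2).
    move=> hp hq hs.
    have sq v c : (`|v| <= e \/ c = 0) -> (v * c) ^+ 2 <= e ^+ 2 * c ^+ 2.
      move=> [h|->]; last by rewrite mulr0 expr0n /= mulr0.
      rewrite exprMn; apply: ler_wpM2r; first exact: sqr_ge0.
      rewrite -(real_normK (num_real v)).
      by rewrite ler_sqr ?nnegrE //; apply: le_trans h.
    have h1 := sq _ _ hp; have h2 := sq _ _ hq; have h3 := sq s z (or_introl hs).
    have := sqr_ge0 (d - (p * x + q * y + s * z)).
    have := sqr_ge0 (p * x - q * y); have := sqr_ge0 (p * x - s * z).
    have := sqr_ge0 (q * y - s * z); nra.
  have wE k : (m < k)%N -> w' k = w (k + r)%N by rewrite /w' ltnNge; case: leqP.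
  have w0 : w (m + r)%N = 0 by apply: wz; rewrite /r; lia.
  have wE' k : (m <= k)%N -> w' k = w (k + r)%N.
    by rewrite leq_eqVlt => /predU1P[<-|/wE //]; rewrite /w' leqnn w0.
  have wEp k : (m <= k.+1)%N -> w' k = w (k + r)%N.
    rewrite leq_eqVlt => /predU1P[mk|/wE' //].
    by rewrite wz /w' ?mk ?leqnSn //; rewrite /r; lia.
  have [r' rE] : exists r', r = r'.+1 by exists r.-1; rewrite /r; lia.
  rewrite /f; case: i mi => [|i] mi.
    have m0 : m = 0%N by lia.
    have wr' : w r' = 0 by apply: wz; move: rE; rewrite /r; lia.
    have -> : jac a b w' 0 = jac a b w (0 + r)%N + (0 * 0 +
       (a 0%N - a (0 + r)%N) * w' 0%N + (b 0%N - b (0 + r)%N) * w' 1%N).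
      by rewrite add0n rE /jac (wE' 0%N) ?(wE' 1%N) ?m0 // rE wr' add0n add1n; ring.
    have := @key 0 (a 0%N - a (0 + r)%N) (b 0%N - b (0 + r)%N) 0 (w' 0%N) (w' 1%N)
      (jac a b w (0 + r)%N).
    rewrite expr0n /=; apply; [by right|left; apply: ae; lia|apply: be; lia].
  have -> : jac a b w' i.+1 = jac a b w (i.+1 + r)%N + ((b i - b (i + r)%N) * w' i
     + (a i.+1 - a (i.+1 + r)%N) * w' i.+1
     + (b i.+1 - b (i.+1 + r)%N) * w' i.+2).
    have -> : (i.+1 + r = (i + r).+1)%N by [].
    by rewrite /jac (wEp i mi) (wE' i.+1 mi) (wE' i.+2 (leqW mi)) !addSn; ring.
  apply: key; [|left; apply: ae; lia|apply: be; lia].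
  have [mi'|im] := leqP m i; first by left; apply: be; lia.
  by right; rewrite /w' (ltnW im).
apply: (@le_trans _ _ (\sum_(i < n) (2 * jac a b w (i + r)%N ^+ 2 +
   6 * e ^+ 2 * ((if nat_of_ord i is i'.+1 then f i' else 0) + f i + f i.+1)))).
  by apply: ler_sum => i _; exact: pt.
rewrite big_split /= -!mulr_sumr !big_split /=.
have h1 := fin_supp_sum_le n fw'.
have h2 : \sum_(i < n) f i.+1 <= \sum_(k < m.+1 + L) f k.
  by apply: le_trans (sum_shift_le n f0) _; exact: fin_supp_sum_le.
have h3 := le_trans (sum_pred_le n f0) h1.
have h4 : \sum_(i < n) jac a b w (i + r)%N ^+ 2 <= dot (jac a b w) (jac a b w).
  apply: le_trans (sum_le_dot (r + n) l2Tw).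
  rewrite big_split_ord /= -[X in X <= _]add0r; apply: lerD.
    by apply: sumr_ge0 => i _; exact: sqr_ge0.
  by apply: ler_sum => i _; rewrite addnC.
rewrite -dw (fin_supp_dot fw'); have := sqr_ge0 e.
rewrite /f in h1 h2 h3 *; nra.
Qed.

End Windows.
(** * Pivots *)

Section Riccati.
Variables (R : realType) (a b : nat -> R) (eta : R).
Implicit Types (u : nat -> R).

(* [riccati k = (A, B, C)] holds the coefficients of the form
   [A p^2 + 2 B p q + C q^2], the minimum of
   [sum_(i <= k) (Tu)_i^2 - eta sum_(i < k) u_i^2] over the vectors [u] with
   [u_k = p] and [u_(k+1) = q]. *)
Fixpoint riccati (k : nat) : R * R * R :=
  match k with
  | 0 => (a 0%N ^+ 2, a 0%N * b 0%N, b 0%N ^+ 2)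
  | k'.+1 =>
    let: (A, B, C) := riccati k' in
    let d := A + b k' ^+ 2 - eta in
    let e := B + b k' * a k in
    let f := b k' * b k in
    (C + a k ^+ 2 - e ^+ 2 / d, a k * b k - e * f / d, b k ^+ 2 - f ^+ 2 / d)
  end.

(** The coefficient of u_k^2 once row k + 1 and the term - eta u_k^2 have been added, that is, the
    k-th pivot of the LDL^T elimination of T^2 - eta. [back_subst] is the critical point in u_k. *)
Definition pivot k := (riccati k).1.1 + b k ^+ 2 - eta.
Definition riccati_form k p q : R :=
  (riccati k).1.1 * p ^+ 2 + 2 * (riccati k).1.2 * p * q
    + (riccati k).2 * q ^+ 2.
Definition back_subst k p q : R :=
  - (((riccati k).1.2 + b k * a k.+1) * p + b k * b k.+1 * q) / pivot k.

Definition partial_form u k : R :=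
  \sum_(i < k.+1) jac a b u i ^+ 2 - eta * \sum_(i < k) u i ^+ 2.

Lemma riccati_form_step k x p q : pivot k != 0 ->
  riccati_form k x p + (b k * x + a k.+1 * p + b k.+1 * q) ^+ 2 - eta * x ^+ 2
  = pivot k * (x - back_subst k p q) ^+ 2 + riccati_form k.+1 p q.
Proof.
rewrite /back_subst /riccati_form /pivot /=.
case: (riccati k) => [[A B] C] /= h; field; exact: h.
Qed.

Lemma partial_formS u n : partial_form u n.+1 =
  partial_form u n + jac a b u n.+1 ^+ 2 - eta * u n ^+ 2.
Proof.
rewrite /partial_form big_ord_recr [X in _ - _ * X = _]big_ord_recr /=; ring.
Qed.

Lemma partial_form_eq u n : (forall k, (k < n)%N -> pivot k != 0) ->
  partial_form u n = \sum_(k < n)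
    pivot k * (u k - back_subst k (u k.+1) (u k.+2)) ^+ 2
    + riccati_form n (u n) (u n.+1).
Proof.
elim: n => [|n IH] h.
  by rewrite /partial_form big_ord1 !big_ord0 /riccati_form /jac /=; ring.
rewrite big_ord_recr /= -addrA -riccati_form_step ?h //.
by rewrite partial_formS (IH (fun k kn => h k (ltnW kn))) /jac; ring.
Qed.

(** The form |Tu|^2 - eta |u|^2 is a sum of squares weighted by the pivots. Being nonpositive, it
    forces every square to vanish, and back-substitution from the zeros past the support kills the
    entries from right to left. *)
Lemma pivots_positive u n : (forall k, (k < n)%N -> 0 < pivot k) ->
  fin_supp n u -> dot (jac a b u) (jac a b u) <= eta * dot u u -> dot u u = 0.
Proof.
move=> hp hu; rewrite (fin_supp_dot hu) (fin_supp_dot (fin_supp_jac a b hu)).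
rewrite -subr_le0 -/(partial_form u n) partial_form_eq; last first.
  by move=> k kn; rewrite gt_eqF ?hp.
rewrite /riccati_form !hu // !(expr0n, mulr0, addr0) /= => hle.
have pos (k : 'I_n) : 0 <= pivot k * (u k - back_subst k (u k.+1) (u k.+2)) ^+ 2.
  by rewrite mulr_ge0 ?sqr_ge0 // ltW // hp.
have /eqP := le_anti (introT andP (conj hle (sumr_ge0 _ (fun k _ => pos k)))).
rewrite psumr_eq0 // => /allP h.
rewrite big1 // => -[k kn] _ /=.
suff H j : (n - j <= k)%N -> u k = 0 by rewrite (H n) ?subnn // expr0n.
elim: j k kn => [|j IH] k kn hj; first by apply: hu; move: hj; rewrite subn0.
have := h (Ordinal kn) (mem_index_enum _).
rewrite /= mulf_eq0 gt_eqF ?hp //= sqrf_eq0 subr_eq0 => /eqP ->.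
have z i : (k < i)%N -> u i = 0.
  move=> ki; have [ni|ni] := leqP n i; first exact: hu.
  by apply: IH => //; lia.
by rewrite /back_subst !z // !mulr0 addr0 oppr0 mul0r.
Qed.

Lemma back_subst_solution k p q :
  exists u, [/\ fin_supp k.+2 u, u k = p, u k.+1 = q &
    forall j, (j < k)%N -> u j = back_subst j (u j.+1) (u j.+2)].
Proof.
elim: k p q => [|k IH] p q.
  exists (fun i => if i is i'.+1 then (if i' is 0%N then q else 0) else p).
  by split=> //; move=> [|[|i]].
have [u [hu up uq hb]] := IH (back_subst k p q) p.
exists (fun i => if i == k.+2 then q else u i); split.
- by move=> i ki; rewrite gtn_eqF // hu // ltnW.
- by rewrite ltn_eqF.
- by rewrite eqxx.
move=> j; rewrite ltnS leq_eqVlt => /predU1P[->|jk].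
  by rewrite eqxx !ltn_eqF // up uq.
have ne i : (i <= k.+1)%N -> (i == k.+2) = false by move=> ik; rewrite ltn_eqF.
rewrite (ne j) ?(ne j.+1) ?(ne j.+2); [exact: hb | clear -jk; lia..].
Qed.

Lemma pivot_nonpositive n k : (k < n)%N -> pivot k <= 0 ->
  exists u, [/\ fin_supp n u, 0 < dot u u &
    dot (jac a b u) (jac a b u) <= eta * dot u u].
Proof.
elim/ltn_ind: k => k IH kn pk.
have [[j jk pj]|H] := pselect (exists2 j, (j < k)%N & pivot j <= 0).
  by apply: IH pj => //; exact: ltn_trans kn.
have hp j : (j < k)%N -> pivot j != 0.
  move=> jk; rewrite gt_eqF // ltNge; apply/negP => pj; apply: H; by exists j.
have [u [hu up uq hb]] := back_subst_solution k 1 0.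
have fu : fin_supp k.+1 u.
  move=> i; rewrite leq_eqVlt => /predU1P[<- //|]; exact: hu.
have u0 : 0 < dot u u.
  by apply: (@dot_gt0 _ _ k); [exact: fin_supp_l2 hu|rewrite up oner_eq0].
exists u; split => //; first by move=> i ni; apply: fu; exact: leq_trans ni.
rewrite -subr_le0 (fin_supp_dot fu) (fin_supp_dot (fin_supp_jac a b fu)).
rewrite -/(partial_form u k.+1) partial_formS partial_form_eq // big1; last first.
  by move=> [j jk] _ /=; rewrite -hb // subrr expr0n mulr0.
rewrite /jac up uq (hu k.+2) // /riccati_form.
move: pk; rewrite /pivot; lra.
Qed.

End Riccati.
(** * Complex Jacobi operators and their spectrum *)

Section ComplexJacobi.
Variable R : realType.
Local Open Scope complex_scope.
Implicit Types (u v : nat -> R[i]) (a b : nat -> R) (z : R[i]) (p q : nat -> R).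

Definition re u : nat -> R := fun k => complex.Re (u k).
Definition im u : nat -> R := fun k => complex.Im (u k).
Definition cseq p q : nat -> R[i] := fun k => p k +i* q k.

Lemma cseq_re_im u : cseq (re u) (im u) = u.
Proof. by apply/funext => k; rewrite /cseq /re /im; case: (u k). Qed.

Lemma normc_sqr z : Normc.normc z ^+ 2 = complex.Re z ^+ 2 + complex.Im z ^+ 2.
Proof. by case: z => x y /=; rewrite sqr_sqrtr // addr_ge0 ?sqr_ge0. Qed.

Lemma ell2P u : ell2 u <-> l2 (re u) /\ l2 (im u).
Proof.
rewrite /ell2; split.
  move=> /cvg_seriesP[|C HC]; first by move=> k; exact: sqr_ge0.
  split; exists C => n; apply: le_trans (HC n); apply: ler_sum => k _;
  rewrite normc_sqr ?lerDl ?lerDr sqr_ge0 //.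
move=> [[C HC] [D HD]]; apply/cvg_seriesP; first by move=> k; exact: sqr_ge0.
exists (C + D) => n; apply: le_trans (lerD (HC n) (HD n)).
by rewrite -big_split /=; apply: ler_sum => k _; rewrite normc_sqr.
Qed.

Definition sqnorm u : R := dot (re u) (re u) + dot (im u) (im u).

Lemma norm2E u : ell2 u -> norm2 u = Num.sqrt (sqnorm u).
Proof.
move=> /ell2P[hr hi]; rewrite /norm2 /sqnorm; congr Num.sqrt.
apply: (cvg_lim (@Rhausdorff R)).
have -> : series (fun k => Normc.normc (u k) ^+ 2) =
  (fun n => \sum_(k < n) re u k * re u k + \sum_(k < n) im u k * im u k).
  apply/funext => n; rewrite seriesEnat /= big_mkord -big_split /=.
  by apply: eq_bigr => k _; rewrite normc_sqr /re /im -!expr2.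
by apply: cvgD; exact: sum_cvg_dot.
Qed.

Lemma sqnorm_ge0 u : ell2 u -> 0 <= sqnorm u.
Proof. by move=> /ell2P[h1 h2]; rewrite addr_ge0 // dot_ge0. Qed.

Lemma norm2_sqr u : ell2 u -> norm2 u ^+ 2 = sqnorm u.
Proof. by move=> hu; rewrite norm2E // sqr_sqrtr // sqnorm_ge0. Qed.

Lemma norm2_ge0 u : 0 <= norm2 u. Proof. exact: sqrtr_ge0. Qed.

Lemma jacobi_opE a b u i : jacobi_op a b u i =
  (if i is i'.+1 then (b i')%:C * u i' else 0) + (a i)%:C * u i
    + (b i)%:C * u i.+1.
Proof.
rewrite /jacobi_op 2!big_ord_recr /= /jacobi_entry eqxx.
rewrite [X in _ + _ + X * _](_ : _ = (b i)%:C); last first.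
  by rewrite ltn_eqF // eqxx.
congr (_ + _ + _); case: i => [|i]; first by rewrite big_ord0.
rewrite big_ord_recr /= big1 ?add0r => [|j _].
  by rewrite gtn_eqF // [(i == i.+2)%N]ltn_eqF // eqxx.
have ji := ltn_ord j.
rewrite (_ : (i.+1 == j) = false)%N; last by rewrite gtn_eqF // ltnW.
rewrite (_ : (nat_of_ord j == i.+2) = false)%N; last by rewrite ltn_eqF // ltnW // ltnW.
by rewrite (_ : (i.+1 == j.+1) = false)%N ?mul0r // gtn_eqF.
Qed.

Lemma jacobi_opE_jac a b u :
  jacobi_op a b u = cseq (jac a b (re u)) (jac a b (im u)).
Proof.
apply/funext => i; rewrite jacobi_opE /cseq /jac /re /im.
have E (x : R) (w : R[i]) : x%:C * w = (x * complex.Re w) +i* (x * complex.Im w).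
  by case: w => s t; apply/eqP; rewrite eq_complex /= !mul0r subr0 addr0 !eqxx.
rewrite !E; case: i => [|i]; rewrite ?E; apply/eqP; rewrite eq_complex /=;
by rewrite ?add0r !eqxx.
Qed.

Lemma jacobi_sub_cseq a b u z (ax := fun k => a k - complex.Re z) :
  (fun k => jacobi_op a b u k - z * u k) =
  cseq (lc (complex.Im z) (im u) (jac ax b (re u)))
       (lc (- complex.Im z) (re u) (jac ax b (im u))).
Proof.
apply/funext => i; rewrite jacobi_opE_jac /ax !jac_shift /cseq /lc /re /im.
clear ax; case: z => x y; case: (u i) => s t.
by apply/eqP; rewrite eq_complex /=; apply/andP; split; apply/eqP; ring.
Qed.

Section Bounded.
Variables (M : R) (a b : nat -> R).
Hypotheses (aM : bounded_by M a) (bM : bounded_by M b).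
Local Notation J := (jacobi_op a b).

Lemma ell2_cseq p q : l2 p -> l2 q -> ell2 (cseq p q).
Proof. by move=> hp hq; apply/ell2P. Qed.

Lemma ell2_jacobi u : ell2 u -> ell2 (J u).
Proof.
move=> /ell2P[h1 h2]; rewrite jacobi_opE_jac.
by apply: ell2_cseq; exact: (l2_jac aM bM).
Qed.

Lemma ell2_lin (c : R[i]) u v : ell2 u -> ell2 v ->
  ell2 (fun k => c * u k + v k).
Proof.
move=> /ell2P[h1 h2] /ell2P[h3 h4].
have -> : (fun k => c * u k + v k) = cseq
  (lc (complex.Re c) (re u) (lc (- complex.Im c) (im u) (re v)))
  (lc (complex.Re c) (im u) (lc (complex.Im c) (re u) (im v))).
  apply/funext => k; rewrite /cseq /lc /re /im; case: c => x y.
  case: (u k) => s t; case: (v k) => s' t'.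
  by apply/eqP; rewrite eq_complex /=; apply/andP; split; apply/eqP; ring.
by apply: ell2_cseq; apply: l2_lc => //; exact: l2_lc.
Qed.

Let axM x : bounded_by (M + `|x|) (fun k => a k - x).
Proof. exact: bounded_shift. Qed.

Let bxM (x : R) : bounded_by (M + `|x|) b.
Proof. by apply: bounded_weak bM; rewrite lerDl. Qed.

(* The cross terms cancel because the real matrix is symmetric. *)
Lemma sqnorm_jacobi_sub u z (ax := fun k => a k - complex.Re z) : ell2 u ->
  sqnorm (fun k => J u k - z * u k) =
    (dot (jac ax b (re u)) (jac ax b (re u)) +
      complex.Im z ^+ 2 * dot (re u) (re u)) +
    (dot (jac ax b (im u)) (jac ax b (im u)) +
      complex.Im z ^+ 2 * dot (im u) (im u)).
Proof.
move=> /ell2P[hr hi]; rewrite jacobi_sub_cseq /sqnorm /re /im /cseq /=.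
rewrite -/(re u) -/(im u) -/ax.
have hTr := l2_jac (@axM (complex.Re z)) (@bxM (complex.Re z)) hr.
have hTi := l2_jac (@axM (complex.Re z)) (@bxM (complex.Re z)) hi.
rewrite (dot_lc (complex.Im z) hi hTr) (dot_lc (- complex.Im z) hr hTi).
rewrite -(dot_jac_sym (@axM (complex.Re z)) (@bxM (complex.Re z)) hr hi).
by rewrite (dotC (im u) (jac _ _ _)); ring.
Qed.

Lemma jacobi_sub_solve z c (ax := fun k => a k - complex.Re z) : 0 < c ->
  coercive ax b (complex.Im z) c -> forall v, ell2 v ->
  exists2 u, ell2 u & (fun k => J u k - z * u k) = v.
Proof.
move=> c0 hc v /ell2P[hr hi].
have [w1 hw1 e1] := solve_coercive (@axM (complex.Re z)) (@bxM (complex.Re z)) c0 hc hr.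
have [w2 hw2 e2] := solve_coercive (@axM (complex.Re z)) (@bxM (complex.Re z)) c0 hc hi.
have hT w : l2 w -> l2 (jac ax b w) by exact: l2_jac (@axM (complex.Re z)) (@bxM _) _.
exists (cseq (lc (- complex.Im z) w2 (jac ax b w1))
             (lc (complex.Im z) w1 (jac ax b w2))).
  by apply: ell2_cseq; apply: l2_lc => //; exact: hT.
rewrite jacobi_sub_cseq -(cseq_re_im v) -e1 -e2 -/ax.
rewrite /jac_sq; congr cseq; rewrite jac_lc; apply/funext => k;
rewrite /lc /re /im /cseq /=; ring.
Qed.

End Bounded.

End ComplexJacobi.

Arguments ell2_lin {R} c [u v].

(** * Resolvent set and approximate eigenvalues *)

Section Spectrum.
Variable R : realType.
Local Open Scope complex_scope.
Implicit Types (u v : nat -> R[i]) (a b : nat -> R) (z : R[i]) (x c M : R).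

Lemma jacobi_sub_lin a b z (c : R[i]) u v :
  (fun k => jacobi_op a b (fun k => c * u k + v k) k - z * (c * u k + v k)) =
  (fun k => c * (jacobi_op a b u k - z * u k) + (jacobi_op a b v k - z * v k)).
Proof.
apply/funext => k; rewrite /jacobi_op.
have -> : \sum_(j < k.+2) (jacobi_entry a b k j)%:C * (c * u j + v j) =
   c * (\sum_(j < k.+2) (jacobi_entry a b k j)%:C * u j) +
   \sum_(j < k.+2) (jacobi_entry a b k j)%:C * v j.
  by rewrite mulr_sumr -big_split /=; apply: eq_bigr => j _; ring.
ring.
Qed.

Lemma jacobi_sub_ge M a b z c u : bounded_by M a -> bounded_by M b ->
  coercive (fun k => a k - complex.Re z) b (complex.Im z) c -> ell2 u ->
  c * sqnorm u <= sqnorm (fun k => jacobi_op a b u k - z * u k).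
Proof.
move=> aM bM hc hu; rewrite (sqnorm_jacobi_sub aM bM z hu).
by case/ell2P: hu => h1 h2; rewrite /sqnorm mulrDr lerD // hc.
Qed.

Lemma sqnorm_eq0 u : ell2 u -> sqnorm u <= 0 -> u = (fun=> 0).
Proof.
move=> /ell2P[hr hi] h; apply/funext => k.
have r0 := coord_le_dot k hr; have i0 := coord_le_dot k hi.
have r1 := dot_ge0 hr; have i1 := dot_ge0 hi; rewrite /sqnorm in h.
have r2 := sqr_ge0 (re u k); have i2 := sqr_ge0 (im u k).
have rz : re u k = 0 by apply/eqP; rewrite -sqrf_eq0; apply/eqP; lra.
have iz : im u k = 0 by apply/eqP; rewrite -sqrf_eq0; apply/eqP; lra.
by rewrite -(cseq_re_im u) /cseq rz iz.
Qed.

(** Solvability provides a right inverse by choice. The lower bound on |(J - z) u| makes J - z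
    injective, which forces linearity and the left inverse law, and bounds the inverse by
    c^(-1/2). *)
Lemma coercive_resolvent M a b z c : bounded_by M a -> bounded_by M b ->
  0 < c -> coercive (fun k => a k - complex.Re z) b (complex.Im z) c ->
  ~ spectrum (jacobi_op a b) z.
Proof.
move=> aM bM c0 hc; apply; set D := fun u k => jacobi_op a b u k - z * u k.
have ellD u : ell2 u -> ell2 (D u).
  move=> hu; have -> : D u = (fun k => - z * u k + jacobi_op a b u k).
    by apply/funext => k; rewrite /D mulNr addrC.
  by apply: ell2_lin => //; exact: (ell2_jacobi aM bM hu).
have inj u v : ell2 u -> ell2 v -> D u = D v -> u = v.
  move=> hu hv e.
  have hw := ell2_lin (- 1) hu hv.
  have := jacobi_sub_ge aM bM hc hw; rewrite jacobi_sub_lin.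
  have -> : (fun k => -1 * (jacobi_op a b u k - z * u k) +
     (jacobi_op a b v k - z * v k)) = cseq (fun=> 0) (fun=> 0).
    apply/funext => k; have := congr1 (fun g => g k) e; rewrite /D => ->.
    by rewrite mulN1r addNr.
  have -> : sqnorm (cseq (fun=> 0) (fun=> 0)) = 0 :> R.
    have z0 : @fin_supp R 0 (fun=> 0) by [].
    by rewrite /sqnorm /re /im /= !(fin_supp_dot z0) big_ord0 addr0.
  rewrite pmulr_rle0 // => /(sqnorm_eq0 hw) h; apply/funext => k.
  have := congr1 (fun g => g k) h; rewrite mulN1r => /eqP.
  by rewrite addrC subr_eq0 => /eqP.
have /choice[S HS] u : exists v, ell2 u -> ell2 v /\ D v = u.
  have [hu|hu] := pselect (ell2 u); last by exists u.
  have [v h1 h2] := jacobi_sub_solve aM bM c0 hc hu.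
  by exists v.
exists S; split; first split; first split.
- by move=> u /HS[].
- move=> t u v hu hv; have [h1 e1] := HS _ hu; have [h2 e2] := HS _ hv.
  have [h3 e3] := HS _ (ell2_lin t hu hv).
  apply: inj => //; first exact: ell2_lin.
  rewrite e3 /D jacobi_sub_lin; apply/funext => k.
  by rewrite -[in LHS]e1 -[in LHS]e2.
- exists (Num.sqrt c^-1) => u hu; have [h1 e1] := HS _ hu.
  rewrite !norm2E // -sqrtrM ?invr_ge0 ?(ltW c0) // ler_sqrt; last first.
    by rewrite mulr_ge0 ?invr_ge0 ?(ltW c0) ?sqnorm_ge0.
  rewrite -(ler_pM2l c0) mulrA mulfV ?gt_eqF // mul1r -[X in _ <= sqnorm X]e1.
  exact: jacobi_sub_ge aM bM hc h1.
- move=> u hu; have [h1 e1] := HS _ (ellD _ hu); split; first exact: inj.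
  by have [] := HS _ hu.
Qed.

(** Off the real axis (Im z)^2 is itself a coercivity constant; on it, coercivity is exactly the
    failure to be an approximate eigenvalue. *)
Lemma spectrum_approx_eigenvalue M a b z : bounded_by M a -> bounded_by M b ->
  spectrum (jacobi_op a b) z ->
  z = (complex.Re z)%:C /\ approx_eigenvalue a b (complex.Re z).
Proof.
move=> aM bM hz.
have [y0|y0] := eqVneq (complex.Im z) 0; last first.
  exfalso; apply: (coercive_resolvent aM bM _ _ hz (c := complex.Im z ^+ 2)).
    by rewrite exprn_even_gt0.
  move=> u hu; rewrite lerDr; apply: dot_ge0.
  apply: (l2_jac (M := M + `|complex.Re z|)) => //; first exact: bounded_shift.
  by apply: bounded_weak bM; rewrite lerDl.
split; first by move: y0; case: (z) => s t /= ->.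
apply: contrapT => /not_approx_eigenvalue[c c0 hc].
apply: (coercive_resolvent aM bM c0 _ hz).
by move=> u hu; rewrite y0 expr0n mul0r addr0; exact: hc.
Qed.

Lemma approx_eigenvalue_spectrum M a b x : bounded_by M a -> bounded_by M b ->
  approx_eigenvalue a b x -> spectrum (jacobi_op a b) x%:C.
Proof.
move=> aM bM hx [S [[_ [B hB]] hS]].
have B0 := sqr_ge0 B.
have [|p [hp p0 hlt]] := hx (B ^+ 2 + 1)^-1; first by rewrite invr_gt0; lra.
pose o : nat -> R := fun=> 0.
have fo : fin_supp 0 o by [].
have hu : ell2 (cseq p o) by apply: ell2_cseq => //; exact: fin_supp_l2 fo.
have hD : ell2 (fun k => jacobi_op a b (cseq p o) k - x%:C * cseq p o k).
  have -> : (fun k => jacobi_op a b (cseq p o) k - x%:C * cseq p o k)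
    = (fun k => - x%:C * cseq p o k + jacobi_op a b (cseq p o) k).
    by apply/funext => k; rewrite mulNr addrC.
  by apply: ell2_lin => //; exact: (ell2_jacobi aM bM hu).
have := hB _ hD; rewrite (hS _ hu).1.
have sqD : sqnorm (fun k => jacobi_op a b (cseq p o) k - x%:C * cseq p o k) =
   dot (jac (fun k => a k - x) b p) (jac (fun k => a k - x) b p).
  rewrite (sqnorm_jacobi_sub aM bM) //= expr0n !mul0r !addr0.
  rewrite [X in _ + X](_ : _ = 0) ?addr0 //.
  have fJ : fin_supp 0 (jac (fun k => a k - x) b o).
    by move=> [|k] _; rewrite /jac /o !mulr0 !addr0.
  by rewrite (fin_supp_dot fJ) big_ord0.
have squ : sqnorm (cseq p o) = dot p p.
  by rewrite /sqnorm [X in _ + X](fin_supp_dot fo) big_ord0 addr0.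
rewrite leNgt => /negP; apply.
(* [bounded_operator] accepts any real constant, so a negative [B] has to be excluded before
   squaring. *)
have [Bn|Bp] := ltP B 0.
  apply: (@le_lt_trans _ _ 0); first by rewrite mulr_le0_ge0 ?norm2_ge0 // ltW.
  by rewrite norm2E // squ sqrtr_gt0.
rewrite -(ltr_pXn2r (n := 2)) ?nnegrE ?norm2_ge0 ?mulr_ge0 ?norm2_ge0 //.
rewrite exprMn !norm2_sqr // sqD squ.
move: hlt; rewrite mulrC ltr_pdivlMr; last by lra.
have hT : 0 <= dot (jac (fun k => a k - x) b p) (jac (fun k => a k - x) b p).
  by rewrite -sqD; exact: sqnorm_ge0.
lra.
Qed.

(** The entries are coordinates of images of unit vectors: [a k] and [b k] are entries k and k + 1
    of J e_k. *)
Lemma bounded_jacobi_entries a b : bounded_operator (jacobi_op a b) ->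
  exists2 M, bounded_by M a & bounded_by M b.
Proof.
move=> [[hl _] [M hM]].
pose e k : nat -> R := fun i => (i == k)%:R.
pose o : nat -> R := fun=> 0.
have fo : fin_supp 0 o by [].
have fe k : fin_supp k.+1 (e k) by move=> i ki; rewrite /e gtn_eqF.
have hu k : ell2 (cseq (e k) o).
  by apply: ell2_cseq; [exact: fin_supp_l2 (fe k) | exact: fin_supp_l2 fo].
have squ k : sqnorm (cseq (e k) o) = 1.
  rewrite /sqnorm [X in _ + X](fin_supp_dot fo) big_ord0 addr0.
  rewrite (fin_supp_dot (fe k)) big_ord_recr /= big1 /e ?eqxx ?add0r ?expr1n //.
  by move=> i _; rewrite ltn_eqF ?expr0n // ltn_ord.
have M0 : 0 <= M.
  have := le_trans (norm2_ge0 _) (hM _ (hu 0%N)).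
  by rewrite norm2E // squ sqrtr1 mulr1.
have H k i : jac a b (e k) i ^+ 2 <= M ^+ 2.
  have hJ := hl _ (hu k).
  have := hM _ (hu k); rewrite [X in _ <= _ * X]norm2E // squ sqrtr1 mulr1.
  move=> h; apply: (@le_trans _ _ (norm2 (jacobi_op a b (cseq (e k) o)) ^+ 2)).
    rewrite norm2_sqr // /sqnorm; case/ell2P: (hJ) => h1 h2.
    have -> : jac a b (e k) i = re (jacobi_op a b (cseq (e k) o)) i.
      by rewrite jacobi_opE_jac.
    have := coord_le_dot i h1; have := dot_ge0 h2; lra.
  by rewrite ler_sqr ?nnegrE ?norm2_ge0.
have sq c : c ^+ 2 <= M ^+ 2 -> `|c| <= M.
  by rewrite -(real_normK (num_real c)) ler_sqr ?nnegrE.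
exists M => k; apply: sq.
  have := H k k; rewrite /jac /e eqxx gtn_eqF // mulr0 addr0 mulr1.
  by case: k => [|k]; rewrite ?add0r // ltn_eqF // mulr0 add0r.
have := H k k.+1; rewrite /jac /e eqxx !gtn_eqF // !mulr0 !addr0 mulr1; exact.
Qed.

(** From x u = J u - (J - x) u one gets x^2 <= 2 (M^2 + 9 M^2) = 20 M^2, and 20 is rounded up to
    5^2. *)
Lemma approx_eigenvalue_le M a b x : 0 < M -> bounded_by M a -> bounded_by M b ->
  approx_eigenvalue a b x -> `|x| <= 5 * M.
Proof.
move=> M0 aM bM hx.
have M2 : 0 < M ^+ 2 by rewrite exprn_gt0.
have [u [hu u0 hlt]] := hx _ M2.
have hT := l2_jac aM bM hu; have hle := dot_jac_le aM bM hu.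
have hS : l2 (jac (fun k => a k - x) b u) by rewrite jac_shift; exact: l2_lc.
have := dot_lc_le (- 1) hS hT.
have -> : lc (-1) (jac (fun k => a k - x) b u) (jac a b u) = (fun k => x * u k).
  by rewrite jac_shift; apply/funext => k; rewrite /lc; ring.
have -> : dot (fun k => x * u k) (fun k => x * u k) = x ^+ 2 * dot u u.
  have -> : (fun k => x * u k) = lc (x - 1) u u.
    by apply/funext => k; rewrite /lc; ring.
  by rewrite dot_lc //; ring.
move=> h; have : x ^+ 2 <= 20 * M ^+ 2 by rewrite -(ler_pM2r u0); lra.
rewrite -(real_normK (num_real x)) => h'.
rewrite -ler_sqr ?nnegrE //; last by lra.
by rewrite exprMn; lra.
Qed.

End Spectrum.
(** * The grid test *)

Section Grid.
Variable R : realType.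
Implicit Types (a b : nat -> R) (x M : R).

Lemma dot_jac_move a b x y M u : bounded_by M a -> bounded_by M b -> l2 u ->
  dot (jac (fun k => a k - x) b u) (jac (fun k => a k - x) b u) <=
  2 * (y - x) ^+ 2 * dot u u +
  2 * dot (jac (fun k => a k - y) b u) (jac (fun k => a k - y) b u).
Proof.
move=> aM bM hu.
have -> : jac (fun k => a k - x) b u = lc (y - x) u (jac (fun k => a k - y) b u).
  by rewrite !jac_shift; apply/funext => k; rewrite /lc; ring.
apply: dot_lc_le => //; rewrite jac_shift; apply: l2_lc => //.
exact: (l2_jac aM bM hu).
Qed.

(** Step 1 / (4 E) on [-5 M, 5 M], the range given by [approx_eigenvalue_le]; hence 40 M E steps. *)
Definition grid_point (E M j : nat) : R := j%:R / (4 * E%:R) - 5 * M%:R.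
Definition grid_size (E M : nat) : nat := (40 * M * E).+1.
(** The sites 0 to m followed by one window. Its length L = 512 M^2 E^2 turns the localisation bound
    32 M^2 / L into 1 / (16 E^2). *)
Definition cutoff (E M m : nat) : nat := m.+1 + 512 * (M * M) * (E * E).

Definition accepted a b (eta x : R) (n : nat) : Prop :=
  exists2 k, (k < n)%N & pivot (fun k => a k - x) b eta k <= 0.

(** Soundness, for every cutoff [n]: the vector behind a nonpositive pivot lies in l^2, so
    truncation creates no spurious points. *)
Lemma accepted_near_eigenvalue a b M (E : nat) x n :
  (0 < E)%N -> bounded_by M a -> bounded_by M b ->
  accepted a b (E%:R ^- 2) x n ->
  exists2 y, approx_eigenvalue a b y & `|x - y| <= E%:R^-1.
Proof.
move=> E0 aM bM [k kn pk].
have [u [hu u0 hle]] := pivot_nonpositive kn pk.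
have bM' : bounded_by (M + `|x|) b by apply: bounded_weak bM; rewrite lerDl.
have [z z2 hz] := approx_eigenvalue_near (bounded_shift x aM) bM'
  (fin_supp_l2 hu) u0 hle.
exists (x + z).
  rewrite /approx_eigenvalue.
  have -> : (fun k => a k - (x + z)) = (fun k => a k - x - z).
    by apply/funext => i; rewrite opprD addrA.
  exact: hz.
have -> : x - (x + z) = - z by ring.
rewrite normrN; move: z2.
by rewrite -(real_normK (num_real z)) -exprVn ler_sqr ?nnegrE.
Qed.

Lemma eigenvalue_near_grid a b (E M m : nat) y :
  (0 < E)%N -> (0 < M)%N -> bounded_by M%:R a -> bounded_by M%:R b ->
  (forall k, (m <= k)%N -> `|a k| + `|b k - 2^-1| <= (24 * E%:R)^-1) ->
  approx_eigenvalue a b y ->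
  exists2 j, (j < grid_size E M)%N &
    `|grid_point E M j - y| <= E%:R^-1 /\
    accepted a b (E%:R ^- 2) (grid_point E M j) (cutoff E M m).
Proof.
move=> E0 M0 aM bM tail hy.
have ER : 0 < E%:R :> R by rewrite ltr0n.
have MR : 0 < M%:R :> R by rewrite ltr0n.
have [y1 y2] : - (5 * M%:R) <= y /\ y <= 5 * M%:R.
  by apply/andP; rewrite -ler_norml; exact: approx_eigenvalue_le hy.
pose t := (y + 5 * M%:R) * (4 * E%:R).
have t0 : 0 <= t by rewrite mulr_ge0 //; lra.
pose j := Num.truncn t.
have /andP[j1 j2] := truncn_itv t0; rewrite -/j in j1 j2.
have xE : grid_point E M j - y = (j%:R - t) / (4 * E%:R).
  by rewrite /grid_point /t; field; rewrite gt_eqF.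
have xy : `|grid_point E M j - y| <= (4 * E%:R)^-1.
  rewrite xE normrM [`|_^-1|]ger0_norm ?invr_ge0 ?mulr_ge0 //.
  rewrite ler_piMl ?invr_ge0 ?mulr_ge0 // ler_norml; rewrite -natr1 in j2; lra.
exists j.
  rewrite ltnS -(ler_nat R); apply: le_trans j1 _.
  rewrite /t !natrM; nra.
set x := grid_point E M j in xy *.
split; first by apply: le_trans xy _; rewrite lef_pV2 ?posrE ?mulr_gt0 //; lra.
pose L := (512 * (M * M) * (E * E))%N.
have L0 : (0 < L)%N by rewrite /L !muln_gt0 M0 E0.
have LE : L%:R = 512 * M%:R ^+ 2 * E%:R ^+ 2 :> R.
  by rewrite /L !natrM !expr2.
have LR : 0 < L%:R :> R by rewrite ltr0n.
have ax z : bounded_by (M%:R + `|z|) (fun k => a k - z) by exact: bounded_shift.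
have bx (z : R) : bounded_by (M%:R + `|z|) b by apply: bounded_weak bM; rewrite lerDl.
have [|u [hu u0 hlt]] := hy (8 * M%:R ^+ 2 / L%:R).
  by rewrite divr_gt0 ?mulr_gt0 ?exprn_gt0.
have [s [w0 hw]] := window_localisation bM MR L0 hu (l2_jac (ax y) (bx y) hu) u0 hlt.
set w := window L s u in w0 hw.
(* Entries past [m] are within 1 / (24 E) of 0 or 1/2, so two of them differ by at most twice
   that. *)
pose e : R := (12 * E%:R)^-1.
have eE : (24 * E%:R)^-1 = e / 2 by rewrite /e; field; rewrite gt_eqF.
have te i k : (m <= i)%N -> (m <= k)%N -> `|(a i - y) - (a k - y)| <= e.
  move=> /tail h1 /tail h2; rewrite opprB addrA subrK.
  apply: le_trans (ler_normB _ _) _; rewrite eE in h1 h2.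
  have := normr_ge0 (b i - 2^-1); have := normr_ge0 (b k - 2^-1); lra.
have tb i k : (m <= i)%N -> (m <= k)%N -> `|b i - b k| <= e.
  move=> /tail h1 /tail h2.
  have -> : b i - b k = (b i - 2^-1) - (b k - 2^-1) by ring.
  apply: le_trans (ler_normB _ _) _; rewrite eE in h1 h2.
  have := normr_ge0 (a i); have := normr_ge0 (a k); lra.
have wsupp k : w k != 0 -> (k < s <= k + L)%N.
  by rewrite /w /window; case: ifP => //; rewrite eqxx.
have [w' [fw' dw' hw']] := shift_window te tb wsupp.
apply: contrapT => /forall2NP H.
have hp k : (k < cutoff E M m)%N -> 0 < pivot (fun k => a k - x) b (E%:R ^- 2) k.
  move=> kn; rewrite ltNge; apply/negP => pk; by have [] := H k.
have := pivots_positive hp fw'; rewrite dw' => h.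
suff h' : dot w w = 0 by rewrite h' ltxx in w0.
apply: h.
have := dot_jac_move x y aM bM (fin_supp_l2 fw'); rewrite dw' => h.
apply: le_trans h _.
have q1 : (y - x) ^+ 2 <= E%:R ^- 2 / 16.
  have -> : E%:R ^- 2 / 16 = ((4 * E%:R)^-1) ^+ 2 :> R by field; rewrite gt_eqF.
  by rewrite -sqrrN opprB -(real_normK (num_real (x - y))) ler_sqr ?nnegrE.
have q2 : 32 * M%:R ^+ 2 / L%:R = E%:R ^- 2 / 16 :> R.
  by rewrite LE; field; rewrite !gt_eqF.
have q3 : e ^+ 2 = E%:R ^- 2 / 144 by rewrite /e; field; rewrite gt_eqF.
rewrite q2 in hw; rewrite q3 in hw'.
have E2 : 0 < E%:R ^- 2 :> R by rewrite invr_gt0 exprn_gt0.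
(* In units of E^-2 |w|^2 the total is 2/16 + 2 (2/16 + 18/144) = 5/8, below the tolerance 1. *)
have := mulr_gt0 E2 w0; have := ler_wpM2r (ltW w0) q1; lra.
Qed.

End Grid.
(** * Executions of programs *)

Section ProgramLogic.
Variable R : realType.
Implicit Types (A B : input R) (p : program) (s : state R) (t : seq (query R)).
Implicit Types Q : state R -> Prop.

(** A run sees its input only through its trace; this gives the locality required by
    [general_algorithm]. *)
Lemma exec_transfer A B p s t s' : exec A p s t s' ->
  (forall q, q \in t -> evaluate A q = evaluate B q) -> exec B p s t s'.
Proof.
elim=> {p s t s'}.
- by move=> *; exact: exec_skip.
- by move=> *; exact: exec_reg.
- by move=> *; exact: exec_mem.
- move=> s a i j H; have /= -> := H _ (mem_head _ _); exact: exec_entry.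
- move=> s x e H; have /= /eqP := H _ (mem_head _ _).
  by rewrite eqr_nat => /eqP ->; exact: exec_tail.
- move=> p1 p2 s1 s2 s3 t1 t2 _ IH1 _ IH2 H.
  by apply: exec_seq; [apply: IH1 | apply: IH2] => q qt; apply: H;
    rewrite mem_cat qt ?orbT.
- by move=> b p1 p2 s t s' _ IH H; apply: exec_if; exact: IH.
- by move=> b p s hb _; exact: exec_while_false.
- move=> b p s1 s2 s3 t1 t2 hb _ IH1 _ IH2 H.
  by apply: exec_while_true hb _ _; [apply: IH1 | apply: IH2] => q qt;
    apply: H; rewrite mem_cat qt ?orbT.
Qed.

Lemma exec_seqV A p1 p2 s t s' : exec A (Seq p1 p2) s t s' ->
  exists t1 t2 s1, [/\ exec A p1 s t1 s1, exec A p2 s1 t2 s' & t = t1 ++ t2].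
Proof.
inversion 1 as [| | | | | q1 q2 r1 r2 r3 u1 u2 h1 h2 | | |]; subst.
by exists u1, u2, r2.
Qed.

Lemma exec_whileV A b p s t s' : exec A (While b p) s t s' ->
  if beval s b then
    exists t1 t2 s1, [/\ exec A p s t1 s1, exec A (While b p) s1 t2 s' & t = t1 ++ t2]
  else t = [::] /\ s' = s.
Proof.
inversion 1 as [| | | | | | | c q r hb | c q r1 r2 r3 u1 u2 hb h1 h2]; subst;
  rewrite hb //.
by exists u1, u2, r2.
Qed.

Lemma exec_deterministic A p s t1 s1 t2 s2 :
  exec A p s t1 s1 -> exec A p s t2 s2 -> t1 = t2 /\ s1 = s2.
Proof.
move=> h; elim: h t2 s2 => {p s t1 s1}.
- by move=> s t2 s2 h; inversion h.
- by move=> s x e t2 s2 h; inversion h.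
- by move=> s a e t2 s2 h; inversion h.
- by move=> s a i j t2 s2 h; inversion h.
- by move=> s x e t2 s2 h; inversion h.
- move=> p1 p2 s1 s2 s3 t1 t2 _ IH1 _ IH2 t' s'.
  move=> /exec_seqV[u1 [u2 [r [/IH1[<- <-] /IH2[<- <-] ->]]]]; by [].
- by move=> b p1 p2 s t s' _ IH t2 s2 h; inversion h; subst; exact: IH.
- by move=> b p s hb t2 s2 /exec_whileV; rewrite hb => -[-> ->].
- move=> b p s1 s2 s3 t1 t2 hb _ IH1 _ IH2 t' s' /exec_whileV; rewrite hb.
  by move=> [u1 [u2 [r [/IH1[<- <-] /IH2[<- <-] ->]]]].
Qed.

(** Total correctness, with termination included. The rules below take the postcondition as a
    continuation, so programs are executed symbolically. *)
Definition runs A p s Q : Prop := exists t s', exec A p s t s' /\ Q s'.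

Lemma runs_weaken A p s Q Q' :
  runs A p s Q -> (forall s', Q s' -> Q' s') -> runs A p s Q'.
Proof. by move=> [t [s' [h hq]]] H; exists t, s'; split=> //; exact: H. Qed.

Lemma runs_reg A x e s Q :
  Q (set_reg s x (neval s e)) -> runs A (SetReg x e) s Q.
Proof. by eexists; eexists; split; first exact: exec_reg. Qed.

Lemma runs_mem A a e s Q :
  Q (Defs.set_mem s (neval s a) (reval s e)) -> runs A (SetMem a e) s Q.
Proof. by eexists; eexists; split; first exact: exec_mem. Qed.

Lemma runs_entry A a i j s Q :
  Q (Defs.set_mem s (neval s a)
       (jacobi_entry (diag A) (offdiag A) (neval s i) (neval s j))) ->
  runs A (ReadEntry a i j) s Q.
Proof. by eexists; eexists; split; first exact: exec_entry. Qed.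

Lemma runs_tail A x e s Q :
  Q (set_reg s x (tail_index A (reval s e))) -> runs A (AskTail x e) s Q.
Proof. by eexists; eexists; split; first exact: exec_tail. Qed.

Lemma runs_seq A p1 p2 s Q :
  runs A p1 s (fun s' => runs A p2 s' Q) -> runs A (Seq p1 p2) s Q.
Proof.
move=> [t [s' [h [t' [s'' [h' hq]]]]]]; exists (t ++ t'), s''; split=> //.
exact: exec_seq h h'.
Qed.

Lemma runs_if A b p1 p2 s Q :
  runs A (if beval s b then p1 else p2) s Q -> runs A (IfThenElse b p1 p2) s Q.
Proof. by move=> [t [s' [h hq]]]; exists t, s'; split=> //; exact: exec_if. Qed.

Lemma runs_if_reg A c x e1 e2 s Q :
  Q (set_reg s x (if beval s c then neval s e1 else neval s e2)) ->
  runs A (IfThenElse c (SetReg x e1) (SetReg x e2)) s Q.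
Proof. by move=> h; apply: runs_if; case: ifP h => _ h; exact: runs_reg. Qed.

Lemma runs_if_mem A c d e1 e2 s Q :
  Q (Defs.set_mem s (neval s d) (if beval s c then reval s e1 else reval s e2)) ->
  runs A (IfThenElse c (SetMem d e1) (SetMem d e2)) s Q.
Proof. by move=> h; apply: runs_if; case: ifP h => _ h; exact: runs_mem. Qed.

Lemma runs_while A b p s Q (I : state R -> Prop) (mu : state R -> nat) :
  (forall s, I s -> beval s b ->
     runs A p s (fun s' => I s' /\ (mu s' < mu s)%N)) ->
  I s -> (forall s', I s' -> beval s' b = false -> Q s') ->
  runs A (While b p) s Q.
Proof.
move=> H + HQ; have [n] := ubnP (mu s); elim: n s => // n IH s sn hI.
case hb : (beval s b); last first.
  by exists [::], s; split; [exact: exec_while_false | exact: HQ].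
have [t [s' [h [hI' hmu]]]] := H _ hI hb.
have [t' [s'' [h' hq]]] := IH s' (leq_trans hmu sn) hI'.
by exists (t ++ t'), s''; split=> //; exact: exec_while_true hb h h'.
Qed.

(* Meaningful only for halting runs; otherwise the value is the start state. *)
Definition result A p s : state R :=
  if pselect (exists s' t, exec A p s t s') is left h then projT1 (cid h) else s.

Lemma resultP A p s Q : runs A p s Q -> Q (result A p s).
Proof.
move=> [t [s' [h hq]]]; rewrite /result; case: pselect => [e|]; last first.
  by case; exists s', t.
by case: cid => s'' /= [t' h']; have [_ <-] := exec_deterministic h h'.
Qed.

(** The evaluation set is the trace of the run: it is finite, unique by determinism, and unchanged
    on any input that agrees along it. *)
Lemma algorithm_result (X : Type) (Omega : set (input R)) p s0
    (decode : state R -> X) :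
  (forall A, Omega A -> runs A p s0 (fun=> True)) ->
  algorithm Omega p s0 decode (fun A => decode (result A p s0)).
Proof.
move=> H; exists (fun A => [set q | exists t s, exec A p s0 t s /\ q \in t]).
have ex A : Omega A -> exists t s, exec A p s0 t s.
  by move=> /H[t [s [h _]]]; exists t, s.
have LE A t s : exec A p s0 t s ->
    [set q | exists t s, exec A p s0 t s /\ q \in t] = [set` t].
  move=> h; apply/seteqP; split=> q /=.
    by move=> [t' [s' [h' qt]]]; have [-> _] := exec_deterministic h h'.
  by exists t, s.
have resE A t s : exec A p s0 t s -> result A p s0 = s.
  move=> h; apply: (@resultP A p s0 (fun s' => s' = s)).
  by exists t, s.
split.
  move=> A /ex[t [s h]]; rewrite (LE _ _ _ h); split; first exact: finite_seq.
  move=> B OB hB; have h' := exec_transfer h hB.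
  by rewrite (LE _ _ _ h') (resE _ _ _ h) (resE _ _ _ h').
move=> A /ex[t [s h]]; exists t, s; split=> //; first exact: LE h.
by rewrite (resE _ _ _ h).
Qed.

End ProgramLogic.

(** * Hausdorff distance *)

Section Hausdorff.
Variable R : realType.
Local Open Scope complex_scope.

Lemma normc_real_sub (x y : R) : Normc.normc (x%:C - y%:C) = `|x - y|.
Proof. by rewrite /= oppr0 addr0 expr0n addr0 sqrtr_sqr. Qed.

Lemma dist_set_ge0 (z : R[i]) (B : set R[i]) : (0 <= dist_set z B)%E.
Proof.
apply: le_ereal_inf_tmp => _ [w _ <-]; rewrite lee_fin; case: (z - w) => x y.
exact: sqrtr_ge0.
Qed.

(** Nonemptiness of [S] serves the lower bound: a supremum over an empty set would be -oo. *)
Lemma hausdorff_bounds (X : set R) (S : set R[i]) (d : R) :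
  S !=set0 -> (forall z, S z -> z = (complex.Re z)%:C) ->
  (forall x, X x -> exists2 y, S y%:C & `|x - y| <= d) ->
  (forall y, S y%:C -> exists2 x, X x & `|x - y| <= d) ->
  (0 <= hausdorff (real_subset X) S <= d%:E)%E.
Proof.
move=> [z0 Sz0] real XS SX; apply/andP; split.
  rewrite le_max; apply/orP; right; apply: ereal_sup_ge.
  by exists (dist_set z0 (real_subset X)); [exists z0 | exact: dist_set_ge0].
rewrite ge_max; apply/andP; split; apply: ge_ereal_sup.
  move=> _ [_ [x Xx <-] <-]; have [y Sy xy] := XS _ Xx.
  apply: (@le_trans _ _ (Normc.normc (x%:C - y%:C))%:E).
    by apply: ereal_inf_lbound; exists y%:C.
  by rewrite normc_real_sub lee_fin.
move=> _ [z Sz <-]; move: (complex.Re z) (real _ Sz) => y zE; subst z.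
have [x Xx xy] := SX _ Sz.
apply: (@le_trans _ _ (Normc.normc (y%:C - x%:C))%:E).
  by apply: ereal_inf_lbound; exists x%:C => //; exists x.
by rewrite normc_real_sub lee_fin distrC.
Qed.

End Hausdorff.
(** * The programs *)

Declare Scope prog_scope.
Notation "p ;; q" := (Seq p q)
  (at level 61, right associativity) : prog_scope.
Local Open Scope prog_scope.

Definition NLt (e1 e2 : nexp) : bexp := BNot (BLe (RNat e2) (RNat e1)).
Definition Cell (c : nat) : rexp := RMem (NConst c).
Definition SetCell (c : nat) : rexp -> program := SetMem (NConst c).
Definition Lit (n : nat) : rexp := RNat (NConst n).
Definition NSucc (x : nexp) : nexp := NAdd x (NConst 1).
Definition RSqr (e : rexp) : rexp := RMul e e.
Definition RSub (e1 e2 : rexp) : rexp := RAdd e1 (ROpp e2).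
Definition RDiv (e1 e2 : rexp) : rexp := RMul e1 (RInv e2).

(* Register 1 holds the tail index; register 2 receives a bound for the
   entries with smaller index. *)
Definition bound_program : program :=
  SetCell 2 (Lit 0) ;;
  SetReg 3 (NConst 0) ;;
  While (NLt (NReg 3) (NReg 1))
    (ReadEntry (NConst 0) (NReg 3) (NReg 3) ;;
     ReadEntry (NConst 1) (NReg 3) (NSucc (NReg 3)) ;;
     SetCell 2 (RAdd (Cell 2)
       (RAdd (Lit 1) (RAdd (RSqr (Cell 0)) (RSqr (Cell 1))))) ;;
     SetReg 3 (NSucc (NReg 3))) ;;
  SetReg 2 (NConst 2) ;;
  While (BNot (BLe (Cell 2) (RNat (NReg 2)))) (SetReg 2 (NSucc (NReg 2))).

(* Cells 0, 1, 2 hold the Riccati coefficients, cell 3 the point x, cells 4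
   and 5 the current entries, cells 6 to 9 the pivot and temporaries; register
   4 holds the cutoff, and register 6 becomes positive when x is accepted. *)
Definition pivot_program (E : nat) : program :=
  SetReg 6 (NConst 0) ;;
  SetReg 3 (NConst 0) ;;
  ReadEntry (NConst 4) (NConst 0) (NConst 0) ;;
  SetCell 4 (RSub (Cell 4) (Cell 3)) ;;
  ReadEntry (NConst 5) (NConst 0) (NConst 1) ;;
  SetCell 0 (RSqr (Cell 4)) ;;
  SetCell 1 (RMul (Cell 4) (Cell 5)) ;;
  SetCell 2 (RSqr (Cell 5)) ;;
  While (NLt (NReg 3) (NReg 4))
    (SetCell 6 (RSub (RAdd (Cell 0) (RSqr (Cell 5))) (RInv (RSqr (Lit E)))) ;;
     IfThenElse (BLe (Cell 6) (Lit 0)) (SetReg 6 (NConst 1))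
       (SetReg 6 (NReg 6)) ;;
     SetCell 7 (Cell 5) ;;
     ReadEntry (NConst 4) (NSucc (NReg 3)) (NSucc (NReg 3)) ;;
     SetCell 4 (RSub (Cell 4) (Cell 3)) ;;
     ReadEntry (NConst 5) (NSucc (NReg 3)) (NSucc (NSucc (NReg 3))) ;;
     SetCell 8 (RAdd (Cell 1) (RMul (Cell 7) (Cell 4))) ;;
     SetCell 9 (RMul (Cell 7) (Cell 5)) ;;
     SetCell 0 (RSub (RAdd (Cell 2) (RSqr (Cell 4)))
       (RDiv (RSqr (Cell 8)) (Cell 6))) ;;
     SetCell 1 (RSub (RMul (Cell 4) (Cell 5))
       (RDiv (RMul (Cell 8) (Cell 9)) (Cell 6))) ;;
     SetCell 2 (RSub (RSqr (Cell 5)) (RDiv (RSqr (Cell 9)) (Cell 6))) ;;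
     SetReg 3 (NSucc (NReg 3))).

Definition output_cell : nexp := NAdd (NConst 10) (NMul (NConst 2) (NReg 5)).

(* A rejected grid point is represented by the empty interval [1, 0]. *)
Definition grid_program (E : nat) : program :=
  SetReg 5 (NConst 0) ;;
  While (NLt (NReg 5) (NSucc (NMul (NMul (NConst 40) (NReg 2)) (NConst E))))
    (SetCell 3 (RSub (RDiv (RNat (NReg 5)) (RMul (Lit 4) (Lit E)))
       (RMul (Lit 5) (RNat (NReg 2)))) ;;
     pivot_program E ;;
     IfThenElse (NLt (NConst 0) (NReg 6)) (SetMem output_cell (Cell 3))
       (SetMem output_cell (Lit 1)) ;;
     IfThenElse (NLt (NConst 0) (NReg 6)) (SetMem (NSucc output_cell) (Cell 3))
       (SetMem (NSucc output_cell) (Lit 0)) ;;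
     SetReg 5 (NSucc (NReg 5))).

(* The first five intervals overlap the working cells and are made empty. *)
Definition spectrum_program (E : nat) : program :=
  AskTail 1 (RInv (RMul (Lit 24) (Lit E))) ;;
  bound_program ;;
  SetReg 4 (NAdd (NSucc (NReg 1)) (NMul (NMul (NConst 512)
    (NMul (NReg 2) (NReg 2))) (NMul (NConst E) (NConst E)))) ;;
  grid_program E ;;
  SetCell 0 (Lit 1) ;; SetCell 1 (Lit 0) ;;
  SetCell 2 (Lit 1) ;; SetCell 3 (Lit 0) ;;
  SetCell 4 (Lit 1) ;; SetCell 5 (Lit 0) ;;
  SetCell 6 (Lit 1) ;; SetCell 7 (Lit 0) ;;
  SetCell 8 (Lit 1) ;; SetCell 9 (Lit 0) ;;
  SetReg 0 (NAdd (NConst 5) (NReg 5)).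

Definition precision_program : program :=
  While (BLe (RMul (Cell 0) (RNat (NSucc (NReg 0)))) (Lit 1))
    (SetReg 0 (NSucc (NReg 0))).

Ltac execute := repeat lazymatch goal with
  | |- runs _ (Seq _ _) _ _ => apply: runs_seq
  | |- runs _ (SetReg _ _) _ _ => apply: runs_reg
  | |- runs _ (SetMem _ _) _ _ => apply: runs_mem
  | |- runs _ (SetCell _ _) _ _ => apply: runs_mem
  | |- runs _ (ReadEntry _ _ _) _ _ => apply: runs_entry
  | |- runs _ (AskTail _ _) _ _ => apply: runs_tail
  | |- runs _ (IfThenElse _ (SetReg _ _) _) _ _ => apply: runs_if_reg
  | |- runs _ (IfThenElse _ (SetMem _ _) _) _ _ => apply: runs_if_mem
  end.

(** * Invariants of the programs *)

Section Correctness.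
Variables (R : realType) (A : input R).
Let a := diag A.
Let b := offdiag A.
Implicit Types (s : state R).

Lemma beval_NLt s e1 e2 : beval s (NLt e1 e2) = (neval s e1 < neval s e2)%N.
Proof. by rewrite /= ler_nat ltnNge. Qed.

Lemma jacobi_entry_diag k : jacobi_entry a b k k = a k.
Proof. by rewrite /jacobi_entry eqxx. Qed.

Lemma jacobi_entry_offdiag k : jacobi_entry a b k k.+1 = b k.
Proof. by rewrite /jacobi_entry ltn_eqF // eqxx. Qed.

(** Without roots or absolute values the machine relies on |x| <= 1 + x^2, summed over the entries
    below the tail index. The search for a natural bound starts at 2 so that the result later covers
    the tail entries too. *)
Lemma runs_bound s : runs A bound_program s (fun s' =>
  [/\ reg s' 1 = reg s 1, (2 <= reg s' 2)%N & forall k, (k < reg s 1)%N ->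
     `|a k| <= (reg s' 2)%:R /\ `|b k| <= (reg s' 2)%:R]).
Proof.
set m := reg s 1.
pose ok s' n := forall k, (k < n)%N -> 1 + (a k * a k + b k * b k) <= Defs.mem s' 2.
rewrite /bound_program; execute.
apply: (runs_while
  (I := fun s' => [/\ reg s' 1 = m, (reg s' 3 <= m)%N, 0 <= Defs.mem s' 2 & ok s' (reg s' 3)])
  (mu := fun s' => (m - reg s' 3)%N)).
- move=> s' [h1 h3 h2 hok]; rewrite beval_NLt /= h1 => lt.
  execute; rewrite /= /update /= !addn1 jacobi_entry_diag jacobi_entry_offdiag.
  have sq := addr_ge0 (sqr_ge0 (a (reg s' 3))) (sqr_ge0 (b (reg s' 3))).
  rewrite !expr2 in sq.
  split; last by lia.
  split => //=; first by lra.
  move=> k /=; rewrite /update /= ltnS leq_eqVlt => /predU1P[->|kl]; first by lra.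
  have := hok _ kl; lra.
- by split => //=; rewrite /update /=.
move=> s1 [h1 h3 h2 hok]; rewrite beval_NLt /= h1 => /negbT; rewrite -leqNgt => h3'.
have h3m : reg s1 3 = m by apply/eqP; rewrite eqn_leq h3 h3'.
rewrite h3m in hok; execute.
pose Bd := (Num.Def.archi_bound (Defs.mem s1 2)).+2.
have hBd : Defs.mem s1 2 <= Bd%:R.
  apply: ltW; apply: lt_le_trans (archi_boundP h2) _.
  by rewrite ler_nat /Bd; lia.
apply: (runs_while
  (I := fun s' => [/\ reg s' 1 = m, (2 <= reg s' 2)%N & Defs.mem s' 2 = Defs.mem s1 2])
  (mu := fun s' => (Bd - reg s' 2)%N)).
- move=> s' [e1 e2 e3] /=; rewrite -ltNge e3 => lt.
  have ltB : (reg s' 2 < Bd)%N.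
    by rewrite -(ltr_nat R); exact: (lt_le_trans lt hBd).
  by execute; rewrite /= /update /=; split; [split => //=|]; lia.
- by split.
move=> s2 [e1 e2 e3] /= /negbFE; rewrite e3 => le; split => // k km.
have := hok _ km.
have key (x y : R) : 1 + (x * x + y * y) <= Defs.mem s1 2 -> `|x| <= (reg s2 2)%:R.
  move=> h; apply: le_trans le; apply: le_trans h.
  rewrite -!expr2 -(real_normK (num_real x)).
  have := sqr_ge0 y; have := sqr_ge0 (`|x| - 1); nra.
by move=> h; split; [exact: key h | apply: (key _ (a k)); rewrite [_ * _ + _]addrC].
Qed.

(** The loop does not stop at a zero pivot: machine and [riccati] share the convention 0^-1 = 0 and
    keep agreeing. The clause on cells from 10 on protects the intervals already written. *)
Lemma runs_pivot E s : runs A (pivot_program E) s (fun s' =>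
  [/\ [/\ reg s' 2 = reg s 2, reg s' 4 = reg s 4 & reg s' 5 = reg s 5],
      Defs.mem s' 3 = Defs.mem s 3, forall c, Defs.mem s' c.+4.+4.+2 = Defs.mem s c.+4.+4.+2 &
      (0 < reg s' 6)%N <-> accepted a b (E%:R ^- 2) (Defs.mem s 3) (reg s 4)]).
Proof.
set x := Defs.mem s 3; set n := reg s 4; set eta := E%:R ^- 2.
pose al k := a k - x.
pose I s' := [/\ [/\ reg s' 2 = reg s 2, reg s' 4 = n & reg s' 5 = reg s 5],
  [/\ Defs.mem s' 3 = x, Defs.mem s' 5 = b (reg s' 3) &
    (Defs.mem s' 0, Defs.mem s' 1, Defs.mem s' 2) = riccati al b eta (reg s' 3)],
  forall c, Defs.mem s' c.+4.+4.+2 = Defs.mem s c.+4.+4.+2,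
  (reg s' 3 <= n)%N &
  (0 < reg s' 6)%N <-> exists2 k, (k < reg s' 3)%N & pivot al b eta k <= 0].
rewrite /pivot_program; execute.
apply: (runs_while (I := I) (mu := fun s' => (n - reg s' 3)%N)).
- move=> s' [[e2 e4 e5] [h3 h5 hric] hfr hk hfl]; rewrite beval_NLt /= e4 => lt.
  execute; rewrite /= /update /= !addn1 jacobi_entry_diag jacobi_entry_offdiag.
  rewrite /I h3 h5 /=.
  have dE : Defs.mem s' 0 + b (reg s' 3) * b (reg s' 3) - (E%:R * E%:R)^-1 =
      pivot al b eta (reg s' 3).
    by rewrite /pivot -hric /= /eta ?expr2.
  rewrite !dE; split; last by lia.
  split => //.
    split => //; rewrite -hric /pivot -hric /= /eta ?expr2.
    by rewrite /al ?expr2.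
  case: ifP => hp /=.
    by split => // _; exists (reg s' 3).
  rewrite hfl; split => -[k kl pk]; exists k => //; first exact: leqW.
  move: kl; rewrite ltnS leq_eqVlt => /predU1P[ek|//].
  by rewrite -ek pk in hp.
- rewrite /I /= /update /= jacobi_entry_diag jacobi_entry_offdiag.
  by split => //; split => // -[].
move=> s' [[e2 e4 e5] [h3 _ _] hfr hk hfl].
rewrite beval_NLt /= e4 => /negbT; rewrite -leqNgt => hk'.
have kn : reg s' 3 = n by apply/eqP; rewrite eqn_leq hk hk'.
by split => //; rewrite hfl kn.
Qed.

End Correctness.
Section MainPrograms.
Variables (R : realType) (A : input R).
Let a := diag A.
Let b := offdiag A.
Implicit Types (s : state R).

Definition grid_cells E M n s i : Prop :=
  let x := grid_point R E M i in
  (accepted a b (E%:R ^- 2) x n ->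
    Defs.mem s i.*2.+4.+4.+2 = x /\ Defs.mem s i.*2.+4.+4.+3 = x) /\
  (~ accepted a b (E%:R ^- 2) x n ->
    Defs.mem s i.*2.+4.+4.+2 = 1 /\ Defs.mem s i.*2.+4.+4.+3 = 0).

Lemma runs_grid E s : runs A (grid_program E) s (fun s' =>
  reg s' 5 = grid_size E (reg s 2) /\
  forall i, (i < grid_size E (reg s 2))%N ->
    grid_cells E (reg s 2) (reg s 4) s' i).
Proof.
set M := reg s 2; set n := reg s 4.
pose I s' := [/\ reg s' 2 = M, reg s' 4 = n, (reg s' 5 <= grid_size E M)%N &
  forall i, (i < reg s' 5)%N -> grid_cells E M n s' i].
rewrite /grid_program; execute.
apply: (runs_while (I := I) (mu := fun s' => (grid_size E M - reg s' 5)%N)).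
- move=> s1 [e2 e4 e5 hcells]; rewrite beval_NLt /= e2 addn1 -/(grid_size E M) => lt.
  execute; apply: (runs_weaken (runs_pivot _ _ _)).
  rewrite /= => s2 [[f2 f4 f5] f3 ffr ffl].
  have x3 : Defs.mem s2 3 = grid_point R E M (reg s1 5).
    by rewrite f3 /update /= e2.
  rewrite /update /= -/(grid_point _ _ _ _) e2 e4 in ffl.
  have cE j : (10 + 2 * j = j.*2.+4.+4.+2)%N by lia.
  execute; rewrite !beval_NLt /= !addn1 /I /= /update /= f5 f2 f4 e2.
  split; last by lia.
  split => // i; rewrite ltnS leq_eqVlt cE => /predU1P[->|il]; rewrite /grid_cells /=.
    rewrite /update /= eqxx ltn_eqF // eqxx x3.
    split=> h; first by have -> : (0 < reg s2 6)%N by apply/ffl.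
    by have -> : (0 < reg s2 6)%N = false by apply/negbTE/negP => /ffl.
  have [h1 h2] := hcells _ il.
  have frame c : (c < (reg s1 5).*2)%N -> Defs.mem s1 c.+4.+4.+2 =
      update (update (Defs.mem s2) (reg s1 5).*2.+4.+4.+2 (if (0 < reg s2 6)%N then Defs.mem s2 3 else 1))
        (reg s1 5).*2.+4.+4.+3 (if (0 < reg s2 6)%N then Defs.mem s2 3 else 0) c.+4.+4.+2.
    by move=> ?; rewrite /update !ltn_eqF ?ffr //; lia.
  by rewrite -!frame //; lia.
- by split.
move=> s' [h2 h4 h5 hc]; rewrite beval_NLt /= h2 addn1 => /negbT.
rewrite -leqNgt => h5'.
have e5 : reg s' 5 = grid_size E M by apply/eqP; rewrite eqn_leq h5 h5'.
by rewrite -e5.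
Qed.

(* Boundedness is essential: the [sup] of an unbounded set is 0. *)
Lemma tail_size_bound m e B : bounded_by B a -> bounded_by B b ->
  tail_size A m < e -> forall k, (m <= k)%N -> `|a k| + `|b k - 2^-1| <= e.
Proof.
move=> aB bB h k mk; apply: le_trans (ltW h); apply: lerD.
  apply: ub_le_sup; last by exists k.
  by exists B => _ [i _ <-]; exact: aB.
apply: ub_le_sup; last by exists k.
exists (B + 2^-1) => _ [i _ <-].
apply: le_trans (ler_normB _ _) _; rewrite [`|2^-1|]ger0_norm ?invr_ge0 //.
by rewrite lerD2r; exact: bB.
Qed.

Lemma runs_spectrum E :
  (0 < E)%N -> compactly_perturbed_inputs A ->
  runs A (spectrum_program E) (init_state 0) (fun s =>
    exists M, [/\ (0 < M)%N, bounded_by M%:R a, bounded_by M%:R b &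
      forall x, set_output s x <-> exists2 j, (j < grid_size E M)%N &
        x = grid_point R E M j /\ accepted a b (E%:R ^- 2) x
          (cutoff E M (tail_index A (24 * E%:R)^-1))]).
Proof.
move=> E0 [[_ hb _] _ htail].
(* [B] is not computed; it only makes the suprema in [tail_size] meaningful. The bound used by the
   machine is [M] below. *)
have [B aB bB] := bounded_jacobi_entries hb.
have e0 : 0 < (24 * E%:R)^-1 :> R by rewrite invr_gt0 mulr_gt0 ?ltr0n.
have tail := tail_size_bound aB bB (htail _ e0).
set m := tail_index A _ in tail *.
rewrite /spectrum_program; execute; rewrite /= -/m.
apply: (runs_weaken (runs_bound _ _)) => s1 [r1 r2 hM]; rewrite /= /update /= in r1 hM.
execute; rewrite /= r1 !addn1; set M := reg s1 2 in r2 hM *.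
have M0 : (0 < M)%N by apply: leq_trans r2.
(* With tolerance at most 1, tail entries are at most 1 + 1/2 in size, hence below [M], which is at
   least 2. *)
have e1 : (24 * E%:R)^-1 <= 1 :> R.
  have := E0; rewrite -(ler_nat R) => E1; rewrite invf_le1; lra.
have M2 : 2 <= M%:R :> R by rewrite ler_nat.
have hab k : `|a k| <= M%:R /\ `|b k| <= M%:R.
  have [km|mk] := ltnP k m; first exact: hM.
  have h := tail _ mk.
  have h1 := normr_ge0 (a k); have h2 := normr_ge0 (b k - 2^-1).
  split; first by lra.
  have -> : b k = (b k - 2^-1) + 2^-1 by rewrite subrK.
  apply: le_trans (ler_normD _ _) _; rewrite [`|2^-1|]ger0_norm ?invr_ge0 //.
  have : (2^-1 : R) <= 1 by lra.
  lra.
apply: (runs_weaken (runs_grid _ _)) => s2; rewrite /= /update /= -/M => -[r5 hc].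
rewrite -/(cutoff E M m) in hc.
execute; rewrite /= r5.
exists M; split => //; first by move=> k; case: (hab k).
  by move=> k; case: (hab k).
move=> x; rewrite /set_output /= /update /=; split.
  move=> [i il]; case: i il => [|[|[|[|[|i]]]]] il /=; try by move=> /andP[]; lra.
  have {}il : (i < grid_size E M)%N by move: il; rewrite -[(5 + _)%N]/(_.+4.+1).
  have [h1 h2] := hc _ il; move=> hx; exists i => //.
  have [acc|nacc] := pselect (accepted a b (E%:R ^- 2) (grid_point R E M i) (cutoff E M m)).
    have [g1 g2] := h1 acc; rewrite g1 g2 in hx.
    have xE : x = grid_point R E M i by apply/le_anti; rewrite andbC.
    by rewrite xE.
  by have [g1 g2] := h2 nacc; rewrite g1 g2 in hx; move: hx => /andP[]; lra.
move=> [j jl [xE acc]]; exists j.+4.+1; first by rewrite -[(5 + _)%N]/(_.+4.+1).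
rewrite xE in acc; have [h1 _] := hc _ jl; have [g1 g2] := h1 acc.
by rewrite /= g1 g2 xE lexx.
Qed.

(** The loop continues while e (n + 1) <= 1, and the archimedean property stops it. The successor
    matches the error 1 / (n + 1) of the n-th algorithm. *)
Lemma runs_precision (e : R) : 0 < e ->
  runs A precision_program (init_state e)
    (fun s => (nat_output s).+1%:R^-1 < e).
Proof.
move=> e0; pose Bd := (Num.Def.archi_bound e^-1).
have hBd : e^-1 < Bd%:R by apply: archi_boundP; rewrite invr_ge0 ltW.
apply: (runs_while (I := fun s => Defs.mem s 0 = e)
  (mu := fun s => (Bd - reg s 0)%N)).
- move=> s he /=; rewrite he addn1 => le1; execute; rewrite /= /update /=.
  split=> //; rewrite addn1.
  suff : ((reg s 0).+1 < Bd)%N by lia.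
  rewrite -(ltr_nat R); apply: le_lt_trans hBd.
  by rewrite -[e^-1]mul1r ler_pdivlMr // mulrC.
- by [].
move=> s he /= /negbT; rewrite he addn1 -ltNge => lt1.
by rewrite /nat_output invf_plt ?posrE // -[e^-1]mul1r ltr_pdivrMr // mulrC.
Qed.

End MainPrograms.
Lemma spectrum_hausdorff (R : realType) (A : input R) (E : nat) (X : set R) M m :
  (0 < E)%N -> (0 < M)%N -> compactly_perturbed_inputs A ->
  bounded_by M%:R (diag A) -> bounded_by M%:R (offdiag A) ->
  m = tail_index A (24 * E%:R)^-1 ->
  (forall x, X x <-> exists2 j, (j < grid_size E M)%N &
     x = grid_point R E M j /\
     accepted (diag A) (offdiag A) (E%:R ^- 2) x (cutoff E M m)) ->
  (0 <= hausdorff (real_subset X) (spectrum (jacobi_of A)) <= (E%:R^-1)%:E)%E.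
Proof.
move=> E0 M0 [_ _ htail] aM bM mE hX.
have e0 : 0 < (24 * E%:R)^-1 :> R by rewrite invr_gt0 mulr_gt0 ?ltr0n.
have tail := tail_size_bound aM bM (htail _ e0); rewrite -mE in tail.
have real z : spectrum (jacobi_of A) z -> z = (complex.Re z)%:C%C.
  by move=> /(spectrum_approx_eigenvalue aM bM)[].
apply: hausdorff_bounds => //.
(* The spectrum is nonempty: at the first basis vector even the crude bound 9 M^2 on |Ju|^2 yields
   an approximate eigenvalue. *)
- pose u : nat -> R := fun i => (i == 0)%N%:R.
  have hu : l2 u by apply: (@fin_supp_l2 _ 1) => -[].
  have u0 : 0 < dot u u by apply: (@dot_gt0 _ _ 0) => //; rewrite oner_eq0.
  have [y _ hy] := approx_eigenvalue_near aM bM hu u0 (dot_jac_le aM bM hu).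
  by exists y%:C%C; exact: approx_eigenvalue_spectrum aM bM hy.
- move=> x /hX[j _ [_ acc]].
  have [y hy xy] := accepted_near_eigenvalue E0 aM bM acc.
  by exists y => //; exact: approx_eigenvalue_spectrum aM bM hy.
move=> y /(spectrum_approx_eigenvalue aM bM)[_ /= hy].
have [j jl [xy acc]] := eigenvalue_near_grid E0 M0 aM bM tail hy.
by exists (grid_point R E M j) => //; apply/hX; exists j.
Qed.

Theorem theorem6p10 (R : realType) :
  computable_with_error_control (@compactly_perturbed_inputs R)
    (fun A : input R => spectrum (jacobi_of A)).
Proof.
(* Taking E = N + 1 keeps E positive; convergence and error control both follow from the single
   bound [HG]. *)
pose G N (A : input R) :=
  set_output (result A (spectrum_program N.+1) (init_state 0)).
have HG N A : compactly_perturbed_inputs A ->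
    (0 <= hausdorff (real_subset (G N A)) (spectrum (jacobi_of A))
       <= (N.+1%:R^-1)%:E)%E.
  move=> OA; have [M [M0 aM bM hX]] := resultP (runs_spectrum (ltn0Sn N) OA).
  exact: (spectrum_hausdorff (ltn0Sn N) M0 OA aM bM erefl hX).
exists G; split.
- move=> N; exists (spectrum_program N.+1); apply: algorithm_result => A OA.
  exact: (runs_weaken (runs_spectrum (ltn0Sn N) OA)).
- move=> A OA.
  apply: (@squeeze_cvge _ _ _ _ (fun=> 0%E) _ (fun N => (N.+1%:R^-1)%:E)).
  + by near=> N; exact: HG.
  + exact: cvg_cst.
  + by apply: cvg_EFin; [near=> N | exact: cvg_harmonic].
exists precision_program.
exists (fun e A => nat_output (result A precision_program (init_state e))).
move=> e e0; split.
  apply: algorithm_result => A _; exact: (runs_weaken (runs_precision A e0)).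
move=> A OA; have := resultP (runs_precision A e0).
move=> h; have /andP[_ hd] := HG (nat_output (result A precision_program (init_state e))) A OA.
by apply: le_lt_trans hd _; rewrite lte_fin.
Unshelve. all: by end_near. Qed.
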